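(* Let $I,J$ be disjoint index sets. For every $N\in\mathbb{N}$ let $\{((a_{N,n,i})_{i\in I},(a_{N,n,j})_{j\in J})\}_{n=1}^N$ be c-bi-free and identically distributed two-faced families in a two-state non-commutative probability space $(\mathcal{A}_N,\varphi_N,\psi_N)$. Let $\hat S_N=((S_{N,i})_{i\in I},(S_{N,j})_{j\in J})$ be the two-faced family defined by $S_{N,k}=\sum_{n=1}^Na_{N,n,k}$, $k\in I\sqcup J$. The following are equivalent: (1) There exists a two-faced family $\hat s=((s_i)_{i\in I},(s_j)_{j\in J})$ in a two-state non-commutative probability space $(\mathcal{A},\varphi,\psi)$ such that $\hat S_N$ converges in distribution to $\hat s$ as $N\to\infty$. (2) For all $d\ge1$ and $\alpha:[d]\to I\sqcup J$, the limits $$\lim_{N\to\infty}N\cdot\psi_N(a_{N,n,\alpha(1)}\cdots a_{N,n,\alpha(d)})\quad\text{and}\quad\lim_{N\to\infty}N\cdot\varphi_N(a_{N,n,\alpha(1)}\cdots a_{N,n,\alpha(d)})$$ exist and are independent of $n$. Moreover, if these assertions hold, then the $(\ell,r)$- and c-$(\ell,r)$-cumulants of $\hat s$ are given by $$\kappa_{\chi_\alpha}(s_{\alpha(1)},\dots,s_{\alpha(d)})=\lim_{N\to\infty}N\cdot\psi_N(a_{N,n,\alpha(1)}\cdots a_{N,n,\alpha(d)}),$$ $$\mathcal{K}_{\chi_\alpha}(s_{\alpha(1)},\dots,s_{\alpha(d)})=\lim_{N\to\infty}N\cdot\varphi_N(a_{N,n,\alpha(1)}\cdots a_{N,n,\alpha(d)})$$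 for all $d\ge1$ and $\alpha:[d]\to I\sqcup J$.
   Context: A two-state non-commutative probability space is a triple $(\mathcal{A},\varphi,\psi)$ with $\mathcal{A}$ a complex unital algebra and $\varphi,\psi$ unital linear functionals. A two-faced family $((a_i)_{i\in I},(a_j)_{j\in J})$ consists of elements of $\mathcal{A}$; those indexed by $I$ are left variables, those indexed by $J$ right variables. Its pair-distribution is the collection of all joint moments $\varphi(a_{\alpha(1)}\cdots a_{\alpha(d)})$, $\psi(a_{\alpha(1)}\cdots a_{\alpha(d)})$, $d\ge1$, $\alpha:[d]\to I\sqcup J$; identically distributed means equal pair-distributions, and convergence in distribution means convergence of all these $\varphi$- and $\psi$-moments. Two-faced families are c-bi-free if the pairs of algebras they generate ($\mathcal{A}_\ell$ = unital algebra generated by the left variables, $\mathcal{A}_r$ = unital algebra generated by the right variables) are c-bi-free. For $\alpha:[d]\to I\sqcup J$, $\chi_\alpha:[d]\to\{\ell,r\}$ is given by $\chi_\alpha(s)=\ell$ if $\alpha(s)\in I$ and $\chi_\alpha(s)=r$ if $\alpha(s)\in J$. **c-bi-freeness.** A two-state vector space with a specified state-vector is $(\mathcal{X},\mathcal{X}^\circ,\xi,\varphi)$ with $\mathcal{X}=\mathbb{C}\xi\oplus\mathcal{X}^\circ$ a complex vector space, $\xi\ne0$, $\varphi:\mathcal{X}\to\mathbb{C}$ linear, $\varphi(\xi)=1$. Let $\psi:\mathcal{X}\to\mathbb{C}$ be linear with $\psi(\xi)=1$, $\ker\psi=\mathcal{X}^\circ$, and for $T\in\mathcal{L}(\mathcal{X})$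 (linear operators) $\varphi_\xi(T)=\varphi(T\xi)$, $\psi_\xi(T)=\psi(T\xi)$. The c-free product $*_{k\in K}(\mathcal{X}_k,\mathcal{X}_k^\circ,\xi_k,\varphi_k)$ is $\mathcal{X}=\mathbb{C}\xi\oplus\mathcal{X}^\circ$, $\mathcal{X}^\circ=\bigoplus_{n\ge1}\bigoplus_{k_1\ne k_2\ne\cdots\ne k_n}\mathcal{X}_{k_1}^\circ\otimes\cdots\otimes\mathcal{X}_{k_n}^\circ$, with $\varphi(\xi)=1$, $\varphi(x_1\otimes\cdots\otimes x_n)=\varphi_{k_1}(x_1)\cdots\varphi_{k_n}(x_n)$. Let $\mathcal{X}(\ell,k)$ (resp. $\mathcal{X}(r,k)$) be the span of $\xi$ and the summands with $k_1\ne k$ (resp. $k_n\ne k$); with the natural identifications $V_k:\mathcal{X}_k\otimes\mathcal{X}(\ell,k)\to\mathcal{X}$, $W_k:\mathcal{X}(r,k)\otimes\mathcal{X}_k\to\mathcal{X}$ put $\lambda_k(T)=V_k(T\otimes I)V_k^{-1}$, $\rho_k(T)=W_k(I\otimes T)W_k^{-1}$. A family $\{(\mathcal{A}_{k,\ell},\mathcal{A}_{k,r})\}_{k\in K}$ of pairs of unital subalgebras is c-bi-free if there are such spaces and unital homomorphisms $\ell_k:\mathcal{A}_{k,\ell}\to\mathcal{L}(\mathcal{X}_k)$, $r_k:\mathcal{A}_{k,r}\to\mathcal{L}(\mathcal{X}_k)$ such that the joint distributions of the family with respect to $\varphi$ and $\psi$ (as functionals on $*_k(\mathcal{A}_{k,\ell}*\mathcal{A}_{k,r})$)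 equal those of $\{(\lambda_k\circ\ell_k(\mathcal{A}_{k,\ell}),\rho_k\circ r_k(\mathcal{A}_{k,r}))\}_{k\in K}$ with respect to $\varphi_\xi$ and $\psi_\xi$. **Cumulants.** For $\chi:[n]\to\{\ell,r\}$ with $\chi^{-1}(\ell)=\{i_1<\cdots<i_p\}$, $\chi^{-1}(r)=\{i_{p+1}>\cdots>i_n\}$, let $i_1\prec_\chi\cdots\prec_\chi i_n$; $\mathcal{BNC}(\chi)$ is the set of partitions of $[n]$ non-crossing for $\prec_\chi$. A block $V$ of $\pi\in\mathcal{BNC}(\chi)$ is interior if some other block $W$ of $\pi$ satisfies $\min_{\prec_\chi}W\prec_\chi\min_{\prec_\chi}V$ and $\max_{\prec_\chi}V\prec_\chi\max_{\prec_\chi}W$; otherwise exterior. The $(\ell,r)$-cumulants $\kappa_\chi$ and c-$(\ell,r)$-cumulants $\mathcal{K}_\chi$ are the multilinear functionals on $\mathcal{A}^n$ uniquely determined by $\psi(a_1\cdots a_n)=\sum_{\pi\in\mathcal{BNC}(\chi)}\prod_{V\in\pi}\kappa_{\chi|_V}((a_1,\dots,a_n)|_V)$ and $\varphi(a_1\cdots a_n)=\sum_{\pi\in\mathcal{BNC}(\chi)}\prod_{V\text{ interior}}\kappa_{\chi|_V}((a_1,\dots,a_n)|_V)\prod_{V\text{ exterior}}\mathcal{K}_{\chi|_V}((a_1,\dots,a_n)|_V)$, where restriction to $V$ keeps the entries indexed by $V$ in increasing order. *)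

(* Defs.v *)
From HB Require Import structures.
From mathcomp Require Import all_boot all_order all_algebra.
From mathcomp Require Import all_classical all_reals all_analysis.
From mathcomp Require Import complex.

Set Implicit Arguments.
Unset Strict Implicit.
Unset Printing Implicit Defensive.

Import Order.TTheory GRing.Theory Num.Theory.
Import numFieldNormedType.Exports.

Local Open Scope ring_scope.

(* Vector spaces with a specified state-vector.  Since X = C xi (+) X° and psi
   is the linear form with psi(xi) = 1 and kernel X°, the pair (xi, psi)
   encodes the decomposition: X° is by definition the kernel of psi. *)
Record two_state_space (C : fieldType) := TwoStateSpace {
  tss_sort :> lmodType C ;
  tss_xi : tss_sort ;
  tss_psi : {scalar tss_sort} ;
  tss_phi : {scalar tss_sort} ;
  tss_psi_xi : tss_psi tss_xi = 1 ;
  tss_phi_xi : tss_phi tss_xi = 1 }.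

Section CFreeProduct.
Variables (C : fieldType) (K : choiceType) (X : K -> two_state_space C).

Definition circ k (x : X k) : X k := x - tss_psi (X k) x *: tss_xi (X k).

(* The word [:: (k_1, x_1); ...; (k_n, x_n)] stands for x_1 (x) ... (x) x_n;
   the empty word stands for xi. *)
Definition word := seq {k : K & X k}.
Definition letter k (x : X k) : {k : K & X k} := Tagged (fun k => X k) x.

Definition reduced (w : word) : bool :=
  all (fun p => tss_psi (X (tag p)) (tagged p) == 0) w
  && sorted (fun i j => i != j) [seq tag p | p <- w].

Definition multilinear_on_reduced (Z : lmodType C) (f : word -> Z) : Prop :=
  forall (u v : word) (k : K) (c : C) (x y : X k),
    reduced (u ++ letter x :: v) -> reduced (u ++ letter y :: v) ->
    f (u ++ letter (c *: x + y) :: v)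
      = c *: f (u ++ letter x :: v) + f (u ++ letter y :: v).

(* The space C xi (+) (+)_(k_1 != ... != k_n) X_(k_1)° (x) ... (x) X_(k_n)° is
   the quotient of the formal linear combinations of words by the relation
   "every multilinear map on the reduced words takes the same value"; words
   which are not reduced are set to 0. *)
Definition formal_eval (Z : lmodType C) (f : word -> Z) (s : seq (C * word)) : Z :=
  \sum_(p <- s | reduced p.2) p.1 *: f p.2.

Definition formal_eqv (s t : seq (C * word)) : bool :=
  `[< forall (Z : lmodType C) (f : word -> Z), multilinear_on_reduced f ->
        formal_eval f s = formal_eval f t >].

Lemma formal_eqv_refl : reflexive formal_eqv.
Proof. by move=> s; apply/asboolP. Qed.

Lemma formal_eqv_sym : symmetric formal_eqv.
Proof. by move=> s t; apply/asboolP/asboolP => h Z f hf; rewrite h. Qed.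

Lemma formal_eqv_trans : transitive formal_eqv.
Proof.
move=> t s u /asboolP h1 /asboolP h2; apply/asboolP => Z f hf.
by rewrite h1 // h2.
Qed.

Canonical formal_eqv_equiv :=
  EquivRel formal_eqv formal_eqv_refl formal_eqv_sym formal_eqv_trans.

Definition cfree_product := {eq_quot formal_eqv_equiv}%qT.

HB.instance Definition _ := Choice.on cfree_product.

Definition to_cfree (s : seq (C * word)) : cfree_product := (\pi_cfree_product s)%qT.

Definition cfree_eval (Z : lmodType C) (f : word -> Z) (q : cfree_product) : Z :=
  formal_eval f (repr q).

Lemma cfree_eval_pi (Z : lmodType C) (f : word -> Z) s :
  multilinear_on_reduced f -> cfree_eval f (to_cfree s) = formal_eval f s.
Proof.
move=> hf; rewrite /cfree_eval /to_cfree.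
have /asboolP -> // : formal_eqv (repr (\pi_cfree_product s)%qT) s.
by apply/eqmodP; rewrite reprK.
Qed.

Lemma cfree_ext (p q : cfree_product) :
  (forall (Z : lmodType C) (f : word -> Z), multilinear_on_reduced f ->
     cfree_eval f p = cfree_eval f q) -> p = q.
Proof.
move=> h; rewrite -[p]reprK -[q]reprK; apply/eqmodP/asboolP => Z f hf.
exact: h.
Qed.

Definition cfree_zero : cfree_product := to_cfree [::].
Definition cfree_scale (c : C) (p : cfree_product) : cfree_product :=
  to_cfree [seq (c * x.1, x.2) | x <- repr p].
Definition cfree_opp (p : cfree_product) : cfree_product := cfree_scale (-1) p.
Definition cfree_add (p q : cfree_product) : cfree_product :=
  to_cfree (repr p ++ repr q).

Section Eval.
Variables (Z : lmodType C) (f : word -> Z).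
Hypothesis hf : multilinear_on_reduced f.

Lemma cfree_eval0 : cfree_eval f cfree_zero = 0.
Proof. by rewrite cfree_eval_pi // /formal_eval big_nil. Qed.

Lemma cfree_evalZ c p : cfree_eval f (cfree_scale c p) = c *: cfree_eval f p.
Proof.
rewrite cfree_eval_pi // /formal_eval big_map scaler_sumr.
by apply: eq_bigr => i _; rewrite scalerA.
Qed.

Lemma cfree_evalN p : cfree_eval f (cfree_opp p) = - cfree_eval f p.
Proof. by rewrite cfree_evalZ scaleN1r. Qed.

Lemma cfree_evalD p q :
  cfree_eval f (cfree_add p q) = cfree_eval f p + cfree_eval f q.
Proof. by rewrite cfree_eval_pi // /formal_eval big_cat. Qed.
End Eval.

Let ev := (cfree_eval0, cfree_evalZ, cfree_evalN, cfree_evalD).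

Lemma cfree_addA : associative cfree_add.
Proof. by move=> p q r; apply: cfree_ext => Z f hf; rewrite !ev // addrA. Qed.
Lemma cfree_addC : commutative cfree_add.
Proof. by move=> p q; apply: cfree_ext => Z f hf; rewrite !ev // addrC. Qed.
Lemma cfree_add0 : left_id cfree_zero cfree_add.
Proof. by move=> p; apply: cfree_ext => Z f hf; rewrite !ev // add0r. Qed.
Lemma cfree_addN : left_inverse cfree_zero cfree_opp cfree_add.
Proof. by move=> p; apply: cfree_ext => Z f hf; rewrite !ev // addNr. Qed.

HB.instance Definition _ := GRing.isZmodule.Build cfree_product
  cfree_addA cfree_addC cfree_add0 cfree_addN.

Lemma cfree_scaleA a b p :
  cfree_scale a (cfree_scale b p) = cfree_scale (a * b) p.
Proof. by apply: cfree_ext => Z f hf; rewrite !ev // scalerA. Qed.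
Lemma cfree_scale1 : left_id 1 cfree_scale.
Proof. by move=> p; apply: cfree_ext => Z f hf; rewrite !ev // scale1r. Qed.
Lemma cfree_scaleDr : right_distributive cfree_scale +%R.
Proof.
by move=> c p q; apply: cfree_ext => Z f hf; rewrite /GRing.add/= !ev // scalerDr.
Qed.
Lemma cfree_scaleDl p : {morph cfree_scale^~ p : a b / a + b}.
Proof.
move=> a b; apply: cfree_ext => Z f hf.
by rewrite [in RHS]/GRing.add/= !ev // scalerDl.
Qed.

HB.instance Definition _ := GRing.Zmodule_isLmodule.Build C cfree_product
  cfree_scaleA cfree_scale1 cfree_scaleDr cfree_scaleDl.

Lemma cfree_eval_is_linear (Z : lmodType C) (f : word -> Z) :
  multilinear_on_reduced f -> linear (cfree_eval f).
Proof.
move=> hf c p q; rewrite -(cfree_evalZ hf).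
exact: (cfree_evalD hf (cfree_scale c p) q).
Qed.

Definition cfree_lift (Z : lmodType C) (f : word -> Z)
    (hf : multilinear_on_reduced f) : {linear cfree_product -> Z} :=
  HB.pack (cfree_eval f)
    (GRing.isLinear.Build C cfree_product Z _ _ (cfree_eval_is_linear hf)).

Definition tensor (w : word) : cfree_product := to_cfree [:: (1, w)].

Lemma cfree_liftE (Z : lmodType C) (f : word -> Z)
    (hf : multilinear_on_reduced f) w : reduced w -> cfree_lift hf (tensor w) = f w.
Proof.
move=> hw; rewrite /cfree_lift/= cfree_eval_pi // /formal_eval big_cons big_nil /=.
by rewrite hw addr0 scale1r.
Qed.

Lemma tensor_multilinear : multilinear_on_reduced tensor.
Proof.
move=> u v k c x y hx hy; have hz : reduced (u ++ letter (c *: x + y) :: v).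
  move: hx hy; rewrite /reduced !all_cat/= => /andP[/and3P[-> /eqP hx ->] hs].
  move=> /andP[/and3P[_ /eqP hy _] _].
  by rewrite linearP hx hy mulr0 addr0 eqxx !map_cat in hs *.
apply: cfree_ext => Z f hf.
have fe w : reduced w -> cfree_eval f (tensor w) = f w by exact: cfree_liftE.
by rewrite (cfree_eval_is_linear hf) !fe // hf.
Qed.

Lemma cfree_span p :
  p = \sum_(s <- repr p | reduced s.2) s.1 *: tensor s.2.
Proof.
apply: cfree_ext => Z f hf; rewrite -[RHS]/(cfree_lift hf _) linear_sum.
by apply: eq_bigr => s hs; rewrite linearZ_LR; congr (_ *: _); rewrite cfree_liftE.
Qed.

Lemma cfree_lift_unique (Z : lmodType C) (f : word -> Z)
    (hf : multilinear_on_reduced f) (g : {linear cfree_product -> Z}) :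
  (forall w, reduced w -> g (tensor w) = f w) -> g =1 cfree_lift hf.
Proof.
move=> hg p; rewrite (cfree_span p) !linear_sum; apply: eq_bigr => s hs.
by rewrite !linearZ_LR; congr (_ *: _); rewrite cfree_liftE // hg.
Qed.

(* V_k : X_k (x) X(l,k) -> X and its inverse, on elementary tensors. The
   elementary tensors of X(l,k) are the reduced words w with left_free k w. *)
Definition left_free (k : K) (w : word) : bool :=
  if w is p :: _ then tag p != k else true.

Definition Vmap k (x : X k) (w : word) : cfree_product :=
  tss_psi (X k) x *: tensor w + tensor (letter (circ x) :: w).

Definition Vinv k (w : word) : X k * word :=
  if w is p :: w' then untag (tss_xi (X k), w) (fun x : X k => (x, w')) p
  else (tss_xi (X k), [::]).

(* W_k : X(r,k) (x) X_k -> X and its inverse, on elementary tensors. *)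
Definition right_free (k : K) (w : word) : bool := left_free k (rev w).

Definition Wmap k (w : word) (x : X k) : cfree_product :=
  tss_psi (X k) x *: tensor w + tensor (rcons w (letter (circ x))).

Definition Winv k (w : word) : word * X k :=
  if rev w is p :: w' then
    untag (w, tss_xi (X k)) (fun x : X k => (rev w', x)) p
  else ([::], tss_xi (X k)).

(* V_k (T (x) I) V_k^-1 and W_k (I (x) T) W_k^-1 on elementary tensors. *)
Definition lambda_word k (T : {linear X k -> X k}) (w : word) : cfree_product :=
  Vmap (T (Vinv k w).1) (Vinv k w).2.
Definition rho_word k (T : {linear X k -> X k}) (w : word) : cfree_product :=
  Wmap (Winv k w).1 (T (Winv k w).2).

Lemma circ_ker k (x : X k) : tss_psi (X k) (circ x) = 0.
Proof. by rewrite linearB linearZ /= tss_psi_xi mulr1 subrr. Qed.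

Lemma circ_linear k : linear (@circ k).
Proof.
move=> c x y; rewrite /circ linearP/= scalerDl scalerBr scalerA opprD.
by rewrite addrACA.
Qed.

Lemma circ_id k (x : X k) : tss_psi (X k) x = 0 -> circ x = x.
Proof. by move=> h; rewrite /circ h scale0r subr0. Qed.

Lemma circ_xi k : circ (tss_xi (X k)) = 0.
Proof. by rewrite /circ tss_psi_xi scale1r subrr. Qed.

Lemma circ_dec k (x : X k) : x = tss_psi (X k) x *: tss_xi (X k) + circ x.
Proof. by rewrite addrC subrK. Qed.

Lemma reduced_cons p w :
  reduced (p :: w) =
    [&& tss_psi (X (tag p)) (tagged p) == 0, reduced w & left_free (tag p) w].
Proof.
rewrite /reduced /=; case: w => [|q w] /=; first by rewrite !andbT.
by rewrite [tag p == _]eq_sym -!andbA; do !bool_congr.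
Qed.

Lemma reduced_rev w : reduced (rev w) = reduced w.
Proof.
rewrite /reduced all_rev map_rev rev_sorted; congr (_ && _).
by apply: eq_sorted => a b; rewrite eq_sym.
Qed.

Lemma reduced_circ k (x : X k) w :
  reduced w -> left_free k w -> reduced (letter (circ x) :: w).
Proof. by move=> hw hk; rewrite reduced_cons/= circ_ker eqxx hw hk. Qed.

Lemma reduced_circr k (x : X k) w :
  reduced w -> right_free k w -> reduced (rcons w (letter (circ x))).
Proof.
by move=> hw hk; rewrite -reduced_rev rev_rcons reduced_circ ?reduced_rev.
Qed.

Lemma Vmap_linear k w : reduced w -> left_free k w ->
  linear (fun x : X k => Vmap x w).
Proof.
move=> hw hk c x y; rewrite /Vmap circ_linear linearP/=.
rewrite (tensor_multilinear (u := [::])) ?cat0s; try exact: reduced_circ.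
by rewrite scalerDl scalerDr scalerA addrACA.
Qed.

Lemma Wmap_linear k w : reduced w -> right_free k w ->
  linear (fun x : X k => Wmap w x).
Proof.
move=> hw hk c x y; rewrite /Wmap circ_linear linearP/= -!cats1.
rewrite tensor_multilinear ?cats1; try exact: reduced_circr.
by rewrite scalerDl scalerDr scalerA addrACA.
Qed.

Lemma Vmap_multilinear k (z : X k) u v k0 c (x y : X k0) :
  reduced (u ++ letter x :: v) -> reduced (u ++ letter y :: v) ->
  left_free k (u ++ letter x :: v) ->
  Vmap z (u ++ letter (c *: x + y) :: v)
    = c *: Vmap z (u ++ letter x :: v) + Vmap z (u ++ letter y :: v).
Proof.
move=> hx hy hk; have hk' : left_free k (u ++ letter y :: v) by case: u hk {hx hy}.
rewrite /Vmap tensor_multilinear // (tensor_multilinear (u := _ :: u)) //;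
  try exact: reduced_circ.
by rewrite !scalerDr !scalerA [_ * c]mulrC addrACA.
Qed.

Lemma Wmap_multilinear k (z : X k) u v k0 c (x y : X k0) :
  reduced (u ++ letter x :: v) -> reduced (u ++ letter y :: v) ->
  right_free k (u ++ letter x :: v) ->
  Wmap (u ++ letter (c *: x + y) :: v) z
    = c *: Wmap (u ++ letter x :: v) z + Wmap (u ++ letter y :: v) z.
Proof.
move=> hx hy hk; have hk' : right_free k (u ++ letter y :: v).
  move: hk; rewrite /right_free !rev_cat !rev_cons -!cats1 -!catA /=.
  by case: (rev v).
rewrite /Wmap tensor_multilinear // !rcons_cat !rcons_cons.
rewrite (tensor_multilinear (u := u)) -?rcons_cons -?rcons_cat //;
  try exact: reduced_circr.
by rewrite !scalerDr !scalerA [_ * c]mulrC addrACA.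
Qed.

Lemma tag_letter p k : tag p = k -> exists z : X k, p = letter z.
Proof. by case: p => k1 z /= <-; exists z. Qed.

Lemma Vinv_letter k (x : X k) w : Vinv k (letter x :: w) = (x, w).
Proof. by rewrite /Vinv /letter (untagE _ _ (erefl : tag (letter x) = k)). Qed.

Lemma Vinv_free k w : left_free k w -> Vinv k w = (tss_xi (X k), w).
Proof. by case: w => //= p w hp; rewrite untag_dflt. Qed.

Lemma Winv_letter k (x : X k) w : Winv k (rcons w (letter x)) = (w, x).
Proof. by rewrite /Winv rev_rcons /letter (untagE _ _ (erefl : tag (letter x) = k))/= revK. Qed.

Lemma Winv_free k w : right_free k w -> Winv k w = (w, tss_xi (X k)).
Proof.
rewrite /right_free /Winv; case E : (rev w) => [|p w'] /= hp.
  by rewrite -(revK w) E.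
by rewrite untag_dflt.
Qed.

Lemma lambda_word_multilinear k (T : {linear X k -> X k}) :
  multilinear_on_reduced (lambda_word T).
Proof.
move=> u v k0 c x y hx hy; rewrite /lambda_word.
case: u hx hy => [|p u] hx hy.
  rewrite !cat0s in hx hy *; have [ek|nk] := eqVneq k0 k.
    subst k0; rewrite !Vinv_letter /= linearP; apply: Vmap_linear.
      by move: hx; rewrite reduced_cons => /and3P[].
    by move: hx; rewrite reduced_cons => /and3P[].
  rewrite !Vinv_free //=; exact: (@Vmap_multilinear _ _ [::]).
have [ek|nk] := eqVneq (tag p) k.
  have [z pz] := tag_letter ek; rewrite {}pz {p ek} in hx hy *; move: hx hy.
  rewrite !cat_cons !reduced_cons => /and3P[_ hx hk] /and3P[_ hy _].
  by rewrite !Vinv_letter /=; apply: Vmap_multilinear.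
by rewrite !Vinv_free //=; apply: (@Vmap_multilinear _ _ (p :: u)).
Qed.

Lemma rho_word_multilinear k (T : {linear X k -> X k}) :
  multilinear_on_reduced (rho_word T).
Proof.
move=> u v k0 c x y; rewrite /rho_word.
case/lastP: v => [|v p] hx hy.
  rewrite !cats1 in hx hy *; have [ek|nk] := eqVneq k0 k.
    subst k0; rewrite !Winv_letter /= linearP; apply: Wmap_linear.
      by move: hx; rewrite -reduced_rev rev_rcons reduced_cons reduced_rev => /and3P[].
    by move: hx; rewrite -reduced_rev rev_rcons reduced_cons => /and3P[].
  rewrite !Winv_free /right_free ?rev_rcons //= -!cats1.
  by apply: Wmap_multilinear; rewrite /right_free cats1 ?rev_rcons // -cats1.
have [ek|nk] := eqVneq (tag p) k.
  have [z pz] := tag_letter ek; rewrite {}pz {p ek} in hx hy *; move: hx hy.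
  rewrite -!rcons_cons -!rcons_cat -reduced_rev rev_rcons reduced_cons reduced_rev.
  move=> /and3P[_ hx hk]; rewrite -reduced_rev rev_rcons reduced_cons reduced_rev.
  move=> /and3P[_ hy _].
  by rewrite !Winv_letter /=; apply: Wmap_multilinear.
have hf (z : X k0) : right_free k (u ++ letter z :: rcons v p).
  by rewrite /right_free -rcons_cons -rcons_cat rev_rcons.
by rewrite !Winv_free //=; apply: Wmap_multilinear.
Qed.

Definition lambda k (T : {linear X k -> X k}) : {linear cfree_product -> cfree_product} :=
  cfree_lift (lambda_word_multilinear T).
Definition rho k (T : {linear X k -> X k}) : {linear cfree_product -> cfree_product} :=
  cfree_lift (rho_word_multilinear T).

Lemma lambda_tensor k (T : {linear X k -> X k}) w :
  reduced w -> lambda T (tensor w) = lambda_word T w.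
Proof. exact: cfree_liftE. Qed.

Lemma rho_tensor k (T : {linear X k -> X k}) w :
  reduced w -> rho T (tensor w) = rho_word T w.
Proof. exact: cfree_liftE. Qed.

Lemma lambdaE k (T : {linear X k -> X k}) (x : X k) w :
  reduced w -> left_free k w -> lambda T (Vmap x w) = Vmap (T x) w.
Proof.
move=> hw hk; rewrite {1}/Vmap linearP !lambda_tensor //;
  last exact: reduced_circ.
rewrite /lambda_word Vinv_free // Vinv_letter /=.
by rewrite -(Vmap_linear hw hk) -linearP -circ_dec.
Qed.

Lemma rhoE k (T : {linear X k -> X k}) (x : X k) w :
  reduced w -> right_free k w -> rho T (Wmap w x) = Wmap w (T x).
Proof.
move=> hw hk; rewrite {1}/Wmap linearP !rho_tensor //;
  last exact: reduced_circr.
rewrite /rho_word Winv_free // Winv_letter /=.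
by rewrite -(Wmap_linear hw hk) -linearP -circ_dec.
Qed.

Definition psi_word (w : word) : C^o := (nilp w)%:R.
Definition phi_word (w : word) : C^o :=
  \prod_(p <- w) tss_phi (X (tag p)) (tagged p).

Lemma psi_word_multilinear : multilinear_on_reduced psi_word.
Proof.
by move=> [|p u] v k c x y _ _; rewrite /psi_word /= scaler0 addr0.
Qed.

Lemma phi_word_multilinear : multilinear_on_reduced phi_word.
Proof.
move=> u v k c x y _ _; rewrite /phi_word !big_cat !big_cons /= linearP/=.
rewrite /GRing.scale/= !mulrDl !mulrDr; congr (_ + _).
by rewrite !mulrA; congr (_ * _ * _); rewrite mulrC.
Qed.

Definition cfree_psi : {scalar cfree_product} := cfree_lift psi_word_multilinear.
Definition cfree_phi : {scalar cfree_product} := cfree_lift phi_word_multilinear.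
Definition cfree_xi : cfree_product := tensor [::].

Lemma cfree_psi_xi : cfree_psi cfree_xi = 1.
Proof. exact: (cfree_liftE psi_word_multilinear). Qed.

Lemma cfree_phi_xi : cfree_phi cfree_xi = 1.
Proof.
by have := cfree_liftE phi_word_multilinear (w := [::]) isT; rewrite /phi_word big_nil.
Qed.

Definition cfree_space : two_state_space C := TwoStateSpace cfree_psi_xi cfree_phi_xi.

End CFreeProduct.

Record two_state_ncps (C : fieldType) := TwoStateNcps {
  ncps_sort :> algType C ;
  ncps_phi : {scalar ncps_sort} ;
  ncps_psi : {scalar ncps_sort} ;
  ncps_phi1 : ncps_phi 1 = 1 ;
  ncps_psi1 : ncps_psi 1 = 1 }.

Variant face := Left | Right.

Definition is_left (f : face) : bool := if f is Left then true else false.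
Lemma is_leftK : cancel is_left (fun b : bool => if b then Left else Right).
Proof. by case. Qed.
HB.instance Definition _ := Equality.copy face (can_type is_leftK).

Definition face_of (I J : Type) (k : I + J) : face :=
  if k is inl _ then Left else Right.

Section CBiFree.
Variables (C : fieldType).

Definition unital_subalgebra (A : algType C) (B : set A) : Prop :=
  [/\ B 1,
      forall (c : C) (x y : A), B x -> B y -> B (c *: x + y)
    & forall x y : A, B x -> B y -> B (x * y)].

(* A unital homomorphism B -> L(X), for a unital subalgebra B; the values of h
   outside B are irrelevant. *)
Definition unital_hom_on (A : algType C) (B : set A) (X : lmodType C)
    (h : A -> {linear X -> X}) : Prop :=
  [/\ forall v, h 1 v = v,
      forall (c : C) (x y : A), B x -> B y ->
        forall v, h (c *: x + y) v = c *: h x v + h y v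
    & forall x y : A, B x -> B y -> forall v, h (x * y) v = h x (h y v)].

Definition free_op (K : choiceType) (X : K -> two_state_space C) (k : K) (f : face)
    (T : {linear X k -> X k}) : {linear cfree_space X -> cfree_space X} :=
  if f is Left then lambda T else rho T.

(* B k Left and B k Right are the left and the right algebra of index k.  A
   functional on the free product of all the B k f is determined by its values
   on the products x_1 ... x_n with x_i in B k_i f_i; such a product is the
   list of the (k_i, f_i, x_i). *)
Definition c_bi_free (A : two_state_ncps C) (K : choiceType)
    (B : K -> face -> set A) : Prop :=
  exists (X : K -> two_state_space C)
         (h : forall k : K, face -> A -> {linear X k -> X k}),
    (forall k f, unital_hom_on (B k f) (h k f)) /\
    forall w : seq (K * face * A),
      (forall k f x, (k, f, x) \in w -> B k f x) ->
      let v := foldr (fun p => free_op p.1.2 (h p.1.1 p.1.2 p.2))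
                     (tss_xi (cfree_space X)) w in
      ncps_phi A (\prod_(p <- w) p.2) = tss_phi (cfree_space X) v /\
      ncps_psi A (\prod_(p <- w) p.2) = tss_psi (cfree_space X) v.

Variables (I J : Type).

Definition face_algebra (A : algType C) (a : I + J -> A) (f : face) : set A :=
  smallest (@unital_subalgebra A) [set x | exists2 k, face_of k = f & x = a k].

Definition c_bi_free_families (A : two_state_ncps C) (K : choiceType)
    (a : K -> I + J -> A) : Prop :=
  c_bi_free (fun k f => face_algebra (a k) f).

Definition joint_monomial (A : algType C) (a : I + J -> A) (d : nat)
    (alpha : 'I_d -> I + J) : A := \prod_(s < d) a (alpha s).

Definition identically_distributed (A B : two_state_ncps C)
    (a : I + J -> A) (b : I + J -> B) : Prop :=
  forall (d : nat) (alpha : 'I_d -> I + J), (0 < d)%N ->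
    ncps_phi A (joint_monomial a alpha) = ncps_phi B (joint_monomial b alpha) /\
    ncps_psi A (joint_monomial a alpha) = ncps_psi B (joint_monomial b alpha).

End CBiFree.

Section BiNonCrossing.
Variables (n : nat) (chi : 'I_n -> face).

Definition chi_lt (i j : 'I_n) : bool :=
  match chi i, chi j with
  | Left, Left => (i < j)%N
  | Left, Right => true
  | Right, Left => false
  | Right, Right => (j < i)%N
  end.

Definition noncrossing (P : {set {set 'I_n}}) : bool :=
  [forall V in P, forall W in P, (V != W) ==>
     ~~ [exists i in V, exists j in W, exists k in V, exists l in W,
           [&& chi_lt i j, chi_lt j k & chi_lt k l]]].

Definition BNC : {set {set {set 'I_n}}} :=
  [set P | finset.partition P [set: 'I_n] & noncrossing P].

Definition is_chi_min (V : {set 'I_n}) (i : 'I_n) : bool :=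
  (i \in V) && [forall j in V, (j == i) || chi_lt i j].

Definition is_chi_max (V : {set 'I_n}) (i : 'I_n) : bool :=
  (i \in V) && [forall j in V, (j == i) || chi_lt j i].

Definition interior_block (P : {set {set 'I_n}}) (V : {set 'I_n}) : bool :=
  [exists W in P, (W != V) &&
    [exists i, exists j, [&& is_chi_min W i, is_chi_min V j & chi_lt i j]] &&
    [exists i, exists j, [&& is_chi_max V i, is_chi_max W j & chi_lt i j]]].

End BiNonCrossing.

(* enum_val enumerates the elements of V in increasing order. *)
Definition restr n (V : {set 'I_n}) (T : Type) (x : 'I_n -> T) : 'I_#|V| -> T :=
  fun i => x (enum_val i).
Arguments restr {n} V {T}.

Section Cumulants.
Variables (C : fieldType) (A : two_state_ncps C).

(* The moment-cumulant formulas solved for the term of the one-block partition;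
   the first argument bounds the recursion depth and is irrelevant as soon as
   it is at least n. *)
Fixpoint kappa_rec (m n : nat) (chi : 'I_n -> face) (a : 'I_n -> A) : C :=
  if m is m'.+1 then
    ncps_psi A (\prod_(i < n) a i)
    - \sum_(P in BNC chi | P != [set [set: 'I_n]])
        \prod_(V in P) kappa_rec m' (restr V chi) (restr V a)
  else 0.

Definition kappa n (chi : 'I_n -> face) (a : 'I_n -> A) : C := kappa_rec n chi a.

Fixpoint ckappa_rec (m n : nat) (chi : 'I_n -> face) (a : 'I_n -> A) : C :=
  if m is m'.+1 then
    ncps_phi A (\prod_(i < n) a i)
    - \sum_(P in BNC chi | P != [set [set: 'I_n]])
        \prod_(V in P)
          if interior_block chi P V then kappa (restr V chi) (restr V a)
          else ckappa_rec m' (restr V chi) (restr V a)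
  else 0.

Definition ckappa n (chi : 'I_n -> face) (a : 'I_n -> A) : C := ckappa_rec n chi a.

Lemma card_block n (P : {set {set 'I_n}}) V :
  finset.partition P [set: 'I_n] -> P != [set [set: 'I_n]] -> V \in P -> (#|V| < n)%N.
Proof.
move=> hP nP hV; rewrite -[n in (_ < n)%N]card_ord -cardsT.
apply: proper_card; rewrite finset.properT; apply: contra nP => /eqP eV.
rewrite finset.eqEsubset finset.sub1set -{2}eV hV andbT; apply/fintype.subsetP => W hW.
rewrite inE; apply/eqP; case/and3P: hP => /eqP cP /finset.trivIsetP tP n0.
apply/eqP; apply: contraT => nW.
have := tP _ _ hV hW; rewrite eV eq_sym => /(_ nW).
rewrite -finset.setI_eq0 finset.setTI => /eqP W0.
by rewrite W0 (negPf n0) in hW.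
Qed.

Lemma kappa_rec_fuel m n (chi : 'I_n -> face) (a : 'I_n -> A) :
  (0 < n)%N -> (n <= m)%N -> kappa_rec m chi a = kappa chi a.
Proof.
elim/ltn_ind: n m chi a => n IH [|m] chi a n0; first by rewrite leqNgt n0.
rewrite /kappa; case: n IH chi a n0 => // n IH chi a _ /= hm.
congr (_ - _); apply: eq_bigr => P /andP[]; rewrite inE => /andP[hP _] nP.
apply: eq_bigr => V hV; have hc := card_block hP nP hV.
have V0 : (0 < #|V|)%N.
  by rewrite card_gt0; case/and3P: hP => _ _; apply: contra => /eqP <-.
by rewrite !IH //; exact: leq_trans hc hm.
Qed.

Lemma ckappa_rec_fuel m n (chi : 'I_n -> face) (a : 'I_n -> A) :
  (0 < n)%N -> (n <= m)%N -> ckappa_rec m chi a = ckappa chi a.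
Proof.
elim/ltn_ind: n m chi a => n IH [|m] chi a n0; first by rewrite leqNgt n0.
rewrite /ckappa; case: n IH chi a n0 => // n IH chi a _ /= hm.
congr (_ - _); apply: eq_bigr => P /andP[]; rewrite inE => /andP[hP _] nP.
apply: eq_bigr => V hV; have hc := card_block hP nP hV.
have V0 : (0 < #|V|)%N.
  by rewrite card_gt0; case/and3P: hP => _ _; apply: contra => /eqP <-.
by case: ifP => // _; rewrite !IH //; exact: leq_trans hc hm.
Qed.

Lemma one_block_BNC n (chi : 'I_n -> face) :
  (0 < n)%N -> [set [set: 'I_n]] \in BNC chi.
Proof.
move=> n0; rewrite inE; apply/andP; split.
  apply/and3P; split.
  - by rewrite /finset.cover finset.big_set1.
  - by apply/finset.trivIsetP => V W /finset.set1P -> /finset.set1P ->; rewrite eqxx.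
  - by rewrite finset.in_set1 eq_sym -card_gt0 cardsT card_ord.
apply/forall_inP => V /finset.set1P ->; apply/forall_inP => W /finset.set1P ->.
by rewrite eqxx.
Qed.

Lemma one_block_exterior n (chi : 'I_n -> face) :
  interior_block chi [set [set: 'I_n]] [set: 'I_n] = false.
Proof.
apply/negbTE/exists_inPn => W /finset.set1P ->; by rewrite eqxx.
Qed.

Lemma restr_setT n (chi : 'I_n -> face) (a : 'I_n -> A)
    (F : forall m, ('I_m -> face) -> ('I_m -> A) -> C) :
  F _ (restr [set: 'I_n] chi) (restr [set: 'I_n] a) = F n chi a.
Proof.
have gen m (e : m = n) (g : 'I_m -> 'I_n) : (forall i, g i = i :> nat) ->
    F m (fun i => chi (g i)) (fun i => a (g i)) = F n chi a.
  case: n / e in chi a g * => hg; have -> // : g = id.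
  by apply: funext => i; apply: val_inj; exact: hg.
apply: gen; first by rewrite cardsT card_ord.
move=> i; rewrite /enum_val enum_setT -enumT nth_enum_ord //.
by rewrite (leq_trans (ltn_ord i)) // cardsT card_ord.
Qed.

Theorem moment_kappa n (chi : 'I_n -> face) (a : 'I_n -> A) : (0 < n)%N ->
  ncps_psi A (\prod_(i < n) a i)
    = \sum_(P in BNC chi) \prod_(V in P) kappa (restr V chi) (restr V a).
Proof.
move=> n0; rewrite (bigD1 _ (one_block_BNC chi n0)) /= finset.big_set1.
rewrite (restr_setT chi a kappa) {1}/kappa; case: n n0 chi a => // n _ chi a /=.
rewrite -[LHS](subrK (\sum_(P in BNC chi | P != [set [set: 'I_n.+1]])
  \prod_(V in P) kappa_rec n (restr V chi) (restr V a))).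
congr (_ + _); apply: eq_bigr => P /andP[]; rewrite inE => /andP[hP _] nP.
apply: eq_bigr => V hV; apply: kappa_rec_fuel; last exact: card_block hP nP hV.
by rewrite card_gt0; case/and3P: hP => _ _; apply: contra => /eqP <-.
Qed.

Theorem moment_ckappa n (chi : 'I_n -> face) (a : 'I_n -> A) : (0 < n)%N ->
  ncps_phi A (\prod_(i < n) a i)
    = \sum_(P in BNC chi)
        (\prod_(V in P | interior_block chi P V) kappa (restr V chi) (restr V a)) *
        (\prod_(V in P | ~~ interior_block chi P V) ckappa (restr V chi) (restr V a)).
Proof.
move=> n0; transitivity (\sum_(P in BNC chi) \prod_(V in P)
  if interior_block chi P V then kappa (restr V chi) (restr V a)
  else ckappa (restr V chi) (restr V a)); last by apply: eq_bigr => P _; apply: big_if.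
rewrite (bigD1 _ (one_block_BNC chi n0)) /= finset.big_set1 one_block_exterior.
rewrite (restr_setT chi a ckappa) {1}/ckappa; case: n n0 chi a => // n _ chi a /=.
rewrite -[LHS](subrK (\sum_(P in BNC chi | P != [set [set: 'I_n.+1]])
  \prod_(V in P) if interior_block chi P V then kappa (restr V chi) (restr V a)
          else ckappa_rec n (restr V chi) (restr V a))).
congr (_ + _); apply: eq_bigr => P /andP[]; rewrite inE => /andP[hP _] nP.
apply: eq_bigr => V hV; case: ifP => // _.
apply: ckappa_rec_fuel; last exact: card_block hP nP hV.
by rewrite card_gt0; case/and3P: hP => _ _; apply: contra => /eqP <-.
Qed.

Theorem kappa_unique (F : forall n, ('I_n -> face) -> ('I_n -> A) -> C) :
  (forall n (chi : 'I_n -> face) (a : 'I_n -> A), (0 < n)%N ->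
     ncps_psi A (\prod_(i < n) a i)
       = \sum_(P in BNC chi) \prod_(V in P) F _ (restr V chi) (restr V a)) ->
  forall n (chi : 'I_n -> face) (a : 'I_n -> A), (0 < n)%N ->
    F n chi a = kappa chi a.
Proof.
move=> hF n; elim/ltn_ind: n => n IH chi a n0.
have := hF n chi a n0; rewrite (moment_kappa chi a n0).
rewrite !(bigD1 _ (one_block_BNC chi n0)) /= !finset.big_set1.
rewrite (restr_setT chi a F) (restr_setT chi a kappa).
rewrite [X in _ + X = _ -> _](_ : _ = \sum_(P in BNC chi | P != [set [set: 'I_n]])
  \prod_(V in P) F _ (restr V chi) (restr V a)); first by move/addIr.
apply: eq_bigr => P /andP[hB nP].
have := hB : P \in BNC chi; rewrite inE => /andP[hP _].
apply: eq_bigr => V hV; rewrite IH //; first exact: card_block hP nP hV.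
by rewrite card_gt0; case/and3P: hP => _ _; apply: contra => /eqP <-.
Qed.

Theorem ckappa_unique (F : forall n, ('I_n -> face) -> ('I_n -> A) -> C) :
  (forall n (chi : 'I_n -> face) (a : 'I_n -> A), (0 < n)%N ->
     ncps_phi A (\prod_(i < n) a i)
       = \sum_(P in BNC chi)
        (\prod_(V in P | interior_block chi P V) kappa (restr V chi) (restr V a)) *
        (\prod_(V in P | ~~ interior_block chi P V) F _ (restr V chi) (restr V a))) ->
  forall n (chi : 'I_n -> face) (a : 'I_n -> A), (0 < n)%N ->
    F n chi a = ckappa chi a.
Proof.
move=> hF n; elim/ltn_ind: n => n IH chi a n0.
have toif (G : forall n, ('I_n -> face) -> ('I_n -> A) -> C) :
    \sum_(P in BNC chi)
        (\prod_(V in P | interior_block chi P V) kappa (restr V chi) (restr V a)) *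
        (\prod_(V in P | ~~ interior_block chi P V) G _ (restr V chi) (restr V a))
    = \sum_(P in BNC chi) \prod_(V in P)
        if interior_block chi P V then kappa (restr V chi) (restr V a)
        else G _ (restr V chi) (restr V a).
  by apply: eq_bigr => P _; apply/esym/big_if.
have := hF n chi a n0; rewrite (moment_ckappa chi a n0) !toif.
rewrite !(bigD1 _ (one_block_BNC chi n0)) /= !finset.big_set1 one_block_exterior.
rewrite (restr_setT chi a F) (restr_setT chi a ckappa).
rewrite [X in _ + X = _ -> _](_ : _ = \sum_(P in BNC chi | P != [set [set: 'I_n]])
  \prod_(V in P)
        if interior_block chi P V then kappa (restr V chi) (restr V a)
        else F _ (restr V chi) (restr V a)); first by move/addIr.
apply: eq_bigr => P /andP[hB nP].
have := hB : P \in BNC chi; rewrite inE => /andP[hP _].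
apply: eq_bigr => V hV; rewrite IH //; first exact: card_block hP nP hV.
by rewrite card_gt0; case/and3P: hP => _ _; apply: contra => /eqP <-.
Qed.

End Cumulants.

Section Limits.
Variables (R : realType) (I J : Type).
Local Notation C := R[i].

(* The topology is attached to numFieldType, hence the casts. *)
Definition complex_cvg (u : nat -> C) (l : C) : Prop :=
  ((u : nat -> (C : numFieldType)) @ \oo --> (l : (C : numFieldType)))%classic.

Definition cvg_in_distribution (A : nat -> two_state_ncps C)
    (S : forall N, I + J -> A N) (B : two_state_ncps C) (s : I + J -> B) : Prop :=
  forall (d : nat) (alpha : 'I_d -> I + J), (0 < d)%N ->
    complex_cvg (fun N => ncps_phi (A N) (joint_monomial (S N) alpha))
                (ncps_phi B (joint_monomial s alpha)) /\
    complex_cvg (fun N => ncps_psi (A N) (joint_monomial (S N) alpha))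
                (ncps_psi B (joint_monomial s alpha)).

(* N * phi_N(a_(N,n,alpha(1)) ... a_(N,n,alpha(d))), and the same for psi *)
Definition scaled_phi_moment (A : nat -> two_state_ncps C)
    (a : forall N, nat -> I + J -> A N) (n d : nat) (alpha : 'I_d -> I + J) : nat -> C :=
  fun N => N%:R * ncps_phi (A N) (joint_monomial (a N n) alpha).

Definition scaled_psi_moment (A : nat -> two_state_ncps C)
    (a : forall N, nat -> I + J -> A N) (n d : nat) (alpha : 'I_d -> I + J) : nat -> C :=
  fun N => N%:R * ncps_psi (A N) (joint_monomial (a N n) alpha).

End Limits.

(* Main.v *)
From HB Require Import structures.
Require Import Defs.
From mathcomp Require Import all_boot all_order all_algebra.
From mathcomp Require Import all_classical all_reals all_analysis.
From mathcomp Require Import complex.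
From mathcomp Require monalg.
From mathcomp Require Import ring zify.
Import Order.TTheory GRing.Theory Num.Theory.
Local Open Scope ring_scope.
Set Implicit Arguments.
Unset Strict Implicit.
Unset Printing Implicit Defensive.

(** Expand a moment of S_N over the colourings k : [d] -> [N] and group them by
    their kernel P.  In the operator model the vector a_1 ... a_d xi is a
    combination of words, in which an operator either acts on the letter of its
    colour at the end of the word it can reach or adds a new letter there; this
    expresses each mixed moment as a universal polynomial in the moments of a
    single family.  Those are O(1/N), every term has at least one factor per
    block of P, and there are N^_#|P| colourings with kernel P, so only the
    terms with exactly one factor per block survive: every block is opened once,
    at its last operator, and is reachable at each of its operators.  Such a
    term exists iff P is bi-non-crossing.  A block is either closed at its first
    operator, with factor psi, or left in the word, with factor phi - psi, and
    exactly the exterior blocks may be left; summing both choices yields phi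
    for the exterior and psi for the interior blocks.  This is the
    moment-cumulant formula, and the term of the one-block partition is N times
    a moment of a single family, so an induction on d identifies the limits
    with the cumulants.  Conversely, limits of all moments are realised on the
    free algebra. *)

(** * Leading terms of the operator recursion *)

Section Deque.
Variable T : Type.
Implicit Types (s : seq T) (f : face).

(** Left operators reach the front of a word and right operators its back, so a single [face]
    argument treats both at once. *)
Definition push f (x : T) s := if f is Left then x :: s else rcons s x.

Definition pop f s : option (T * seq T) :=
  match f, s with
  | Left, x :: s' => Some (x, s')
  | Right, x :: s' => Some (last x s', belast x s')
  | _, [::] => None
  end.

Variant pop_spec f s : option (T * seq T) -> Type :=
  | PopNone of s = [::] : pop_spec f s None
  | PopSome x s' of s = push f x s' : pop_spec f s (Some (x, s')).

Lemma popP f s : pop_spec f s (pop f s).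
Proof.
case: s => [|x s]; first by case: f; constructor.
by case: f => /=; constructor => //=; rewrite -lastI.
Qed.

Lemma pop_nil f : pop f [::] = None.
Proof. by case: f. Qed.

Lemma push_pop f x s : pop f (push f x s) = Some (x, s).
Proof.
case: f => //=; case: s => //= y s.
by rewrite last_rcons belast_rcons.
Qed.

Lemma size_push f x s : size (push f x s) = (size s).+1.
Proof. by case: f; rewrite /= ?size_rcons. Qed.

Lemma all_push (P : pred T) f x s : all P (push f x s) = P x && all P s.
Proof. by case: f; rewrite //= all_rcons. Qed.

Lemma pairwise_push (r : rel T) f x s :
  pairwise r (push f x s)
  = all (fun y => if f is Left then r x y else r y x) s && pairwise r s.
Proof. by case: f; rewrite //= pairwise_rcons. Qed.
End Deque.

Lemma mem_push (T : eqType) (f : face) (x : T) s : push f x s =i x :: s.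
Proof. by case: f => // y; rewrite mem_rcons. Qed.

Lemma uniq_push (T : eqType) (f : face) (x : T) s :
  uniq (push f x s) = (x \notin s) && uniq s.
Proof. by case: f; rewrite //= rcons_uniq. Qed.

Lemma map_push (T U : Type) (g : T -> U) (f : face) x s :
  map g (push f x s) = push f (g x) (map g s).
Proof. by case: f; rewrite //= map_rcons. Qed.

(* The letter (q, V) of a word stands for the vector (a_V xi_q)°, where a_V is
   the ordered product over V of operators of colour q. *)
Section Recursion.
Variables (T : eqType) (D : finType) (C : comNzRingType).
Variables (col : T -> D) (chi : T -> face).
Local Notation letters := (seq (D * seq T)).
Implicit Types (l : seq T) (w : letters).

(* The value fin (a_i_1 ... a_i_m w), where l = [:: i_m; ...; i_1] lists the
   operators in the order in which they act. *)
Fixpoint val_rec (p : seq T -> C) (fin : letters -> C) l w : C :=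
  if l is i :: l' then
    let k := col i in
    let insert w' := p [:: i] * val_rec p fin l' w'
                     + val_rec p fin l' (push (chi i) (k, [:: i]) w') in
    if pop (chi i) w is Some (x, w') then
      if x.1 == k then
        p (i :: x.2) * val_rec p fin l' w'
        + val_rec p fin l' (push (chi i) (k, i :: x.2) w')
        - p x.2 * insert w'
      else insert w
    else insert w
  else fin w.

Definition recurs k l := k \in map col l.
Definition occurs k w := k \in unzip1 w.

(* Each letter of w, and each colour of l which is not in w, contributes at
   least one factor. *)
Definition weight l w : nat :=
  (size w + #|[pred q | recurs q l && ~~ occurs q w]|)%N.

(* The terms of val_rec with exactly weight l w factors. *)
Fixpoint lead_rec (p : seq T -> C) (fin : letters -> C) l w : C :=
  if l is i :: l' then
    let k := col i in
    let insert := if occurs k w then 0 else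
        (if recurs k l' then 0 else p [:: i] * lead_rec p fin l' w)
        + lead_rec p fin l' (push (chi i) (k, [:: i]) w) in
    if pop (chi i) w is Some (x, w') then
      if x.1 == k then
        (if recurs k l' && ~~ occurs k w' then 0
         else p (i :: x.2) * lead_rec p fin l' w')
        + lead_rec p fin l' (push (chi i) (k, i :: x.2) w')
      else insert
    else insert
  else fin w.

Lemma occurs_push k f x w : occurs k (push f x w) = (k == x.1) || occurs k w.
Proof. by rewrite /occurs /unzip1 map_push mem_push inE. Qed.

(** The [weight] lemmas compare the least number of factors before and after each move; the excess
    shows which moves [lead_rec] drops. Opening a letter costs extra exactly when its colour is
    already in the word. *)
Lemma weight_push i l f V w :
  weight l (push f (col i, V) w)
  = ((occurs (col i) w) + weight (i :: l) w)%N.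
Proof.
rewrite /weight size_push; set A := #|_|; set B := #|_|.
suff -> : B = (~~ occurs (col i) w + A)%N by case: (occurs _ _) => /=; lia.
rewrite /A /B (cardD1 (col i)) !inE /recurs /= inE eqxx /=; congr (_ + _)%N.
apply: eq_card => q; rewrite !inE occurs_push /=.
by case: (q == col i); rewrite //= andbF.
Qed.

(** A letter opened and closed at once contributes the factor [p [:: i]]; this is of leading order
    only if the colour is neither in [w] nor still to come. *)
Lemma weight_skip i l w :
  weight (i :: l) w
  = (weight l w + (~~ occurs (col i) w && ~~ recurs (col i) l))%N.
Proof.
rewrite /weight -addnA; congr addn.
set P := [pred q | recurs q (i :: l) && _]; set Q := [pred q | recurs q l && _].
rewrite (cardD1 (col i) P) (cardD1 (col i) Q).
have -> : #|[predD1 P & col i]| = #|[predD1 Q & col i]|.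
  by apply: eq_card => q; rewrite !inE /recurs /= inE; case: (q == col i).
rewrite !inE /recurs /= inE eqxx /=.
by case: (_ \in _); case: occurs => /=; rewrite ?addn0 // addnC.
Qed.

Lemma weight_keep i l f V V' w :
  weight l (push f (col i, V) w) = weight (i :: l) (push f (col i, V') w).
Proof.
rewrite /weight !size_push; congr addn; apply: eq_card => q.
by rewrite !inE !occurs_push /recurs /= inE; case: (q == col i); rewrite ?andbF.
Qed.

(** Closing a letter is of leading order unless its colour returns later while no other letter of
    that colour is in the word. *)
Lemma weight_close i l f V w :
  (weight (i :: l) (push f (col i, V) w)
   + (recurs (col i) l && ~~ occurs (col i) w))%N = (weight l w).+1.
Proof.
rewrite -(weight_keep i l f [::]) weight_push weight_skip.
by case: recurs; case: occurs => /=; lia.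
Qed.
End Recursion.

(** * Limits of sequences scaled by powers of [N] *)

Import numFieldNormedType.Exports.

Definition tends (K : numFieldType) (u : nat -> K) (l : K) : Prop :=
  (u @ \oo --> l)%classic.

Section Tends.
Variable K : numFieldType.
Implicit Types (u v : nat -> K) (a b : K).

Lemma tendsD u v a b : tends u a -> tends v b -> tends (fun N => u N + v N) (a + b).
Proof. exact: cvgD. Qed.

Lemma tendsM u v a b : tends u a -> tends v b -> tends (fun N => u N * v N) (a * b).
Proof. exact: cvgM. Qed.

Lemma tendsN u a : tends u a -> tends (fun N => - u N) (- a).
Proof. exact: cvgN. Qed.

Lemma tends_cst a : tends (fun=> a) a.
Proof. exact: cvg_cst. Qed.

Lemma tends_eventually M u v a :
  (forall N, (M <= N)%N -> u N = v N) -> tends v a -> tends u a.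
Proof.
move=> h; apply: cvg_trans; apply: near_eq_cvg.
by exists M => // N /= hN; rewrite h.
Qed.
End Tends.

Lemma tends_invn (R : realType) : @tends R[i] (fun N => N%:R^-1) 0.
Proof.
apply/cvgr0Pnorm_lt => e e0.
(* A positive element for the order of the complex numbers is real, which reduces the estimate to
   the archimedean property of [R]. *)
have [er e0'] : e = (complex.Re e)%:C%C /\ (0 < complex.Re e)%R.
  by move: e0; case: e => x y; rewrite ltcE /= => /andP[/eqP -> ->].
exists (Num.bound (complex.Re e)^-1) => // N /= hN.
have hb := archi_boundP (ltW (etrans (invr_gt0 _) e0')).
have N0 : (0 < (N%:R : R)).
  apply: (@lt_le_trans _ _ (Num.bound (complex.Re e)^-1)%:R); last by rewrite ler_nat.
  by apply: lt_trans hb; rewrite invr_gt0.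
rewrite normrV ?unitfE ?pnatr_eq0 -?lt0n -?(ltr0n R) // normr_nat er.
rewrite -[X in X^-1](rmorph_nat (real_complex R)) -fmorphV ltcR.
by rewrite invf_plt ?posrE //; apply: lt_le_trans hb _; rewrite ler_nat.
Qed.

Section Scaling.
Variable K : numFieldType.
Hypothesis tends_inv : @tends K (fun N => N%:R^-1) 0.
Implicit Types (u v : nat -> K) (a b : K).
Opaque tends.

Definition scaled (e : nat) u : nat -> K := fun N => N%:R ^+ e * u N.

(** Each missing power of [N] divides a convergent sequence by [N] and forces the limit 0. This is
    how terms with more factors than the weight disappear. *)
Lemma scaled_low e k u a : tends (scaled (e + k) u) a ->
  tends (scaled e u) (if k is 0 then a else 0).
Proof.
case: k => [|k] h; first by rewrite addn0 in h.
apply: (@tends_eventually _ 1 _ (fun N => N%:R^-1 ^+ k.+1 * scaled (e + k.+1) u N)).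
  move=> N N0; rewrite /scaled exprVn addnC exprD !mulrA.
  by rewrite mulVf ?mul1r // expf_neq0 // pnatr_eq0 -lt0n.
suff hk : tends (fun N => N%:R^-1 ^+ k.+1 : K) 0.
  by have := tendsM hk h; rewrite mul0r.
have <- : 0 ^+ k.+1 = 0 :> K by rewrite expr0n.
elim: k.+1 => [|j IH]; first exact: tends_cst.
rewrite exprS; under eq_fun do rewrite exprS.
exact: (tendsM tends_inv IH).
Qed.

Lemma scaledD e u v a b : tends (scaled e u) a -> tends (scaled e v) b ->
  tends (scaled e (fun N => u N + v N)) (a + b).
Proof.
by move=> hu hv; rewrite /scaled; under eq_fun do rewrite mulrDr; exact: (tendsD hu hv).
Qed.

Lemma scaledB e u v a b : tends (scaled e u) a -> tends (scaled e v) b ->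
  tends (scaled e (fun N => u N - v N)) (a - b).
Proof.
move=> hu hv; apply: (scaledD hu).
by rewrite /scaled; under eq_fun do rewrite mulrN; exact: (tendsN hv).
Qed.

Lemma scaledM e f u v a b : tends (scaled e u) a -> tends (scaled f v) b ->
  tends (scaled (e + f) (fun N => u N * v N)) (a * b).
Proof.
move=> hu hv; rewrite /scaled; under eq_fun do rewrite exprD mulrACA.
exact: (tendsM hu hv).
Qed.

Lemma tends_sum (T : Type) (r : seq T) (P : pred T) (F : T -> nat -> K) (G : T -> K) :
  (forall k, P k -> tends (F k) (G k)) ->
  tends (fun N => \sum_(k <- r | P k) F k N) (\sum_(k <- r | P k) G k).
Proof.
move=> h; elim: r => [|k r IH].
  by rewrite big_nil; under eq_fun do rewrite big_nil; exact: tends_cst.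
rewrite big_cons; under eq_fun do rewrite big_cons.
by case: ifP => // Pk; exact: (tendsD (h k Pk) IH).
Qed.

(** The falling factorial is asymptotic to the power, so counting colourings amounts to one factor
    [N] per block. *)
Lemma scaled_ffact (b : nat) u (x : K) : tends (scaled b u) x ->
  tends (fun N => (N ^_ b)%:R * u N) x.
Proof.
move=> hu; have ratio : tends (fun N => (N ^_ b)%:R * N%:R^-1 ^+ b) (1 : K).
  elim: b {hu} => [|b IH]; first by under eq_fun do rewrite mul1r; exact: tends_cst.
  (* This is (N - b)/N, the factor by which the ratio changes from [b] to [b.+1] once N exceeds
     b. *)
  have h1 : tends (fun N => 1 - b%:R * N%:R^-1) (1 - b%:R * 0 : K).
    apply: (@tendsD K (fun=> 1)); first exact: tends_cst.
    apply: (@tendsN K); apply: (@tendsM K (fun=> b%:R)); first exact: tends_cst.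
    exact: tends_inv.
  rewrite mulr0 subr0 in h1; have := tendsM IH h1; rewrite mulr1.
  apply: (tends_eventually (M := b.+1)) => N hN.
  rewrite ffactnSr natrM natrB ?(ltnW hN) // exprSr mulrACA; congr (_ * _).
  by rewrite mulrBl mulfV // pnatr_eq0 -lt0n; apply: leq_trans hN.
have := tendsM ratio hu; rewrite mul1r.
apply: (tends_eventually (M := 1)) => N hN.
rewrite /scaled mulrA -(mulrA _ (_^-1 ^+ b)) exprVn mulVf ?mulr1 //.
by rewrite expf_neq0 // pnatr_eq0 -lt0n.
Qed.
End Scaling.

(** * Convergence of the recursion to its leading terms *)

Section Asymptotics.
Variables (C : numFieldType) (T : eqType) (D : finType).
Hypothesis tends_inv : @tends C (fun N => N%:R^-1) 0.
Opaque tends.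
Variables (col : T -> D) (chi : T -> face).
Variables (p : nat -> seq T -> C) (fin : nat -> seq (D * seq T) -> C).
Variables (lp : seq T -> C) (lfin : seq (D * seq T) -> C) (m : nat).

(** Only moments of length below [m] are assumed to converge: the induction on the length of the
    word knows no more when it meets partitions with several blocks. *)
Let short (V : seq T) := (0 < size V < m)%N.

Hypothesis hp : forall V, short V -> tends (scaled 1 (fun N => p N V)) (lp V).
Hypothesis hfin : forall w, all (fun x => short x.2) w ->
  tends (scaled (size w) (fun N => fin N w)) (lfin w).

(** A letter may still absorb every remaining operator of its colour, so it is the eventual length
    that must stay below [m]. *)
Let good l (w : seq (D * seq T)) :=
  all (fun x => (0 < size x.2)%N && (size x.2 + count (fun j => col j == x.1) l < m)%N) w.

(** Every factor is O(1/N), so scaling by [N] to the power [weight] keeps the terms with exactly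
    that many factors and kills the others. The weight identities match the branches of [val_rec]
    with those of [lead_rec]. *)
Lemma val_rec_cvg l w :
  (forall q, (count (fun j => col j == q) l < m)%N) -> good l w ->
  tends (scaled (weight col l w) (fun N => val_rec col chi (p N) (fin N) l w))
    (lead_rec col chi lp lfin l w).
Proof.
elim: l w => [|i l IH] w hl hw.
  rewrite /weight /recurs /= (eq_card0 (A := [pred q | _])) ?addn0; last by move=> q; rewrite inE.
  apply: hfin; apply: sub_all hw => x /andP[x0].
  by rewrite /= addn0 /short x0.
have hl' q : (count (fun j => col j == q) l < m)%N.
  by apply: leq_ltn_trans (hl q); rewrite /= leq_addl.
have hk : ((count (fun j => col j == col i) l).+1 < m)%N.
  by move: (hl (col i)); rewrite /= eqxx.
have good_tail w1 : good (i :: l) w1 -> good l w1.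
  apply: sub_all => x /andP[-> /=]; apply: leq_ltn_trans.
  by rewrite leq_add2l leq_addl.
set k := col i.
pose ins N w1 := p N [:: i] * val_rec col chi (p N) (fin N) l w1
                 + val_rec col chi (p N) (fin N) l (push (chi i) (k, [:: i]) w1).
pose lins w1 := if occurs k w1 then 0 else
  (if recurs col k l then 0 else lp [:: i] * lead_rec col chi lp lfin l w1)
  + lead_rec col chi lp lfin l (push (chi i) (k, [:: i]) w1).
have hins w1 : good (i :: l) w1 ->
    tends (scaled (weight col (i :: l) w1) (ins^~ w1)) (lins w1).
  move=> /good_tail hw1.
  have h1 : tends (scaled (weight col l w1).+1
      (fun N => p N [:: i] * val_rec col chi (p N) (fin N) l w1))
      (lp [:: i] * lead_rec col chi lp lfin l w1).
    by rewrite -add1n; apply: scaledM; [apply: hp; rewrite /short /=; lia | exact: IH].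
  have h2 : tends (scaled (weight col l (push (chi i) (k, [:: i]) w1))
      (fun N => val_rec col chi (p N) (fin N) l (push (chi i) (k, [:: i]) w1)))
      (lead_rec col chi lp lfin l (push (chi i) (k, [:: i]) w1)).
    by apply: IH => //; rewrite /good all_push; apply/andP; split; rewrite //= add1n.
  rewrite /ins /lins weight_push addnC in h2 *.
  have := weight_skip col i l w1; rewrite -/k.
  case: (occurs k w1) h2 => /= h2 e.
    rewrite -[0]addr0; apply: scaledD; last exact: (scaled_low tends_inv h2).
    by apply: (@scaled_low _ tends_inv _ 1 _ _ _); rewrite e addn0 addn1; exact: h1.
  apply: scaledD; last by rewrite addn0 in h2.
  case: (recurs col k l) e => /= e; rewrite e; last by rewrite addn1.
  by rewrite addn0; apply: (@scaled_low _ tends_inv _ 1 _ _ _); rewrite addn1; exact: h1.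
rewrite /=; case: popP => [_|x w' ew]; first exact: hins.
rewrite -/k; have [ek|_] := eqVneq x.1 k; last exact: hins.
case: x ek ew => _ V /= -> ew; move: hw; rewrite {}ew /good all_push /= eqxx.
move=> /andP[/andP[V0 hV]] hw'; have hw1 : good l w' := good_tail _ hw'.
have sV : short V by rewrite /short; lia.
have siV : short (i :: V) by rewrite /short /=; lia.
(* The subtracted term of [val_rec] always has a factor too many, so its limit is 0. *)
rewrite -[lead in tends _ lead]subr0.
have ec := weight_close col i l (chi i) V w'.
apply: scaledB; [apply: scaledD|].
- have h : tends (scaled (weight col l w').+1
      (fun N => p N (i :: V) * val_rec col chi (p N) (fin N) l w'))
      (lp (i :: V) * lead_rec col chi lp lfin l w').
    by rewrite -add1n; apply: scaledM; [exact: hp | exact: IH].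
  by rewrite -ec in h; have := scaled_low tends_inv h; rewrite -/k; case: (_ && _).
- rewrite -(weight_keep col i l _ (i :: V)); apply: IH => //.
  rewrite /good all_push; apply/andP; split; last exact: hw1.
  by move: hV => /=; rewrite -/k; lia.
have h : tends (scaled (weight col (i :: l) w').+1
      (fun N => p N V * ins N w')) (lp V * lins w').
  by rewrite -add1n; apply: scaledM; [exact: hp | exact: hins].
have es := weight_skip col i l w'.
move: es ec h; rewrite /lins -/k; case: (occurs k w') => /= es ec h.
  move: h; rewrite mulr0 es.
  by rewrite -(_ : weight col (i :: l) (push (chi i) (k, V) w') = (weight col l w' + 0).+1) //; lia.
apply: (@scaled_low _ tends_inv _ 1 _ _ _); rewrite addn1.
have -> : weight col (i :: l) (push (chi i) (k, V) w') = weight col (i :: l) w'; last exact: h.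
by move: es ec; case: (recurs col k l) => /=; lia.
Qed.
End Asymptotics.

(** * Evaluation of the leading terms *)

Section LeadingTerm.
Variables (T : eqType) (D : finType) (C : comNzRingType).
Variables (col : T -> D) (chi : T -> face) (lp g : seq T -> C).
Implicit Types (l r : seq T) (w : seq (D * seq T)) (s : seq D) (E : {set D}).

Lemma lead_rec_sum (K : finType) (F : K -> seq (D * seq T) -> C) l w :
  lead_rec col chi lp (fun w => \sum_e F e w) l w
  = \sum_e lead_rec col chi lp (F e) l w.
Proof.
elim: l w => //= i l IH w; set k := col i.
have ins w1 : (if occurs k w1 then 0 else
    (if recurs col k l then 0
     else lp [:: i] * lead_rec col chi lp (fun w => \sum_e F e w) l w1) +
    lead_rec col chi lp (fun w => \sum_e F e w) l (push (chi i) (k, [:: i]) w1))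
  = \sum_e (if occurs k w1 then 0 else
    (if recurs col k l then 0 else lp [:: i] * lead_rec col chi lp (F e) l w1) +
    lead_rec col chi lp (F e) l (push (chi i) (k, [:: i]) w1)).
  case: (occurs k w1); first by rewrite big1.
  rewrite !IH big_split /=; congr (_ + _).
  by case: recurs; [rewrite big1 | rewrite mulr_sumr].
case: pop => [[x w']|] //; case: (x.1 == k) => //.
rewrite !IH big_split /=; congr (_ + _).
by case: (_ && _); [rewrite big1 | rewrite mulr_sumr].
Qed.

(* The part of the final evaluation where E is the set of colours left in
   the word. *)
Definition fin_on E w : C :=
  if [set q | occurs q w] == E then \prod_(x <- w) g x.2 else 0.

(** No remaining operator touches colour [k], so its presence in the final word is already settled
    and has to agree with [E]. *)
Lemma lead_rec_eq0 E k l w : ~~ recurs col k l -> (k \in E) != occurs k w ->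
  lead_rec col chi lp (fin_on E) l w = 0.
Proof.
elim: l w => [|i l IH] w; rewrite /recurs /= => hk hE.
  rewrite /fin_on; case: eqP => // e; move: hE.
  by rewrite -e inE eqxx.
move: hk; rewrite inE negb_or => /andP[nk hk].
have ins w1 : occurs k w1 = occurs k w ->
    (if occurs (col i) w1 then 0 else
    (if recurs col (col i) l then 0
     else lp [:: i] * lead_rec col chi lp (fin_on E) l w1) +
    lead_rec col chi lp (fin_on E) l (push (chi i) (col i, [:: i]) w1)) = 0.
  move=> e; case: (occurs (col i) w1) => //.
  rewrite !IH ?e // ?mulr0 ?if_same ?addr0 //.
  by rewrite occurs_push /= (negPf nk) e.
case: popP => [_|x w' ew]; first exact: ins.
case: eqP => ex; last exact: ins.
have ew' : occurs k w = occurs k w' by rewrite ew occurs_push ex (negPf nk).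
rewrite !IH -?ew' ?mulr0 ?if_same ?addr0 //.
by rewrite occurs_push /= (negPf nk) -ew'.
Qed.

(* Which colours are open, from left to right; the colours in E are never
   closed, the others are closed at their last operator. *)
Fixpoint feasible E l s : bool :=
  if l is i :: l' then
    let k := col i in
    let stays := recurs col k l' || (k \in E) in
    if pop (chi i) s is Some (q, s') then
      if q == k then feasible E l' (if stays then s else s')
      else (k \notin s) && feasible E l' (if stays then push (chi i) k s else s)
    else (k \notin s) && feasible E l' (if stays then push (chi i) k s else s)
  else [set q in s] == E.

(** Here [r] lists the operators that have acted, the latest first. In a leading term an open letter
    has absorbed all of them that have its colour, so the open colours determine the word. *)
Definition block_of r q := [seq j <- r | col j == q].
Definition word_of r s := [seq (q, block_of r q) | q <- s].

Lemma occurs_word_of q r s : occurs q (word_of r s) = (q \in s).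
Proof. by rewrite /occurs /unzip1 -map_comp map_id. Qed.

Lemma block_of_catrev q l r : ~~ recurs col q l ->
  block_of (catrev l r) q = block_of r q.
Proof.
elim: l r => //= i l IH r; rewrite /recurs /= inE negb_or => /andP[n1 n2].
by rewrite IH //= eq_sym (negPf n1).
Qed.

Lemma word_of_cons i r s : col i \notin s -> word_of (i :: r) s = word_of r s.
Proof.
move=> hi; apply/eq_in_map => q hq /=; case: eqP => // e.
by rewrite e hq in hi.
Qed.

(** At each operator, later occurrences and [E] decide between keeping and closing its colour, the
    other choice vanishing; hence at most one term is left. The hypothesis on [r] excludes a colour
    that was closed and returns. *)
Lemma lead_rec_feasible E l r s : uniq s ->
  (forall q, recurs col q r -> recurs col q l -> q \in s) ->
  lead_rec col chi lp (fin_on E) l (word_of r s)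
  = if feasible E l s then
      \prod_(q | (q \in s) || recurs col q l)
        (if q \in E then g else lp) (block_of (catrev l r) q)
    else 0.
Proof.
elim: l r s => [|i l IH] r s us hs.
  rewrite /= /fin_on; have -> : [set q | occurs q (word_of r s)] = [set q in s].
    by apply/setP => q; rewrite !inE occurs_word_of.
  case: eqP => // e; rewrite big_map [RHS](eq_bigl (mem s)); last first.
    by move=> q; rewrite /= orbF.
  rewrite -big_uniq //= [LHS]big_seq [RHS]big_seq; apply: eq_bigr => q hq /=.
  by rewrite -e inE hq.
set k := col i.
have hs1 s1 : uniq s1 -> (forall q, q != k -> (q \in s1) = (q \in s)) ->
    (k \in s1) || ~~ recurs col k l ->
    forall q, recurs col q (i :: r) -> recurs col q l -> q \in s1.
  move=> _ e hk q; have [-> _ hl|nq] := eqVneq q k.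
    by rewrite hl orbF in hk.
  rewrite e // /recurs /= inE -/k (negPf nq) /= => h1 h2.
  by apply: hs => //; rewrite /recurs /= inE h2 orbT.
have ins : k \notin s ->
  (if recurs col k l then 0
     else lp [:: i] * lead_rec col chi lp (fin_on E) l (word_of r s)) +
  lead_rec col chi lp (fin_on E) l (push (chi i) (k, [:: i]) (word_of r s))
  = if feasible E l (if recurs col k l || (k \in E) then push (chi i) k s else s) then
      \prod_(q | (q \in s) || recurs col q (i :: l))
        (if q \in E then g else lp) (block_of (catrev (i :: l) r) q)
    else 0.
  (* Colour [k] is not open although it acts now, so it has not acted before and its letter starts
     as [[:: i]]. *)
  move=> ks; have kr : ~~ recurs col k r.
    by apply: contra ks => /hs; apply; rewrite /recurs /= inE eqxx.
  have bk : block_of (i :: r) k = [:: i].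
    rewrite /= eqxx; congr cons; apply: size0nil; rewrite size_filter.
    apply/eqP; rewrite -leqn0 leqNgt -has_count; apply: contra kr.
    by case/hasP => j jr /eqP <-; exact: map_f.
  have -> : push (chi i) (k, [:: i]) (word_of r s) = word_of (i :: r) (push (chi i) k s).
    rewrite /word_of map_push bk; congr push.
    exact/esym/word_of_cons.
  have us' : uniq (push (chi i) k s) by rewrite uniq_push ks.
  have [stay|close] := boolP (recurs col k l || (k \in E)).
    have -> : (if recurs col k l then 0
       else lp [:: i] * lead_rec col chi lp (fin_on E) l (word_of r s)) = 0.
      move: stay; case: (boolP (recurs col k l)) => //= nk kE.
      by rewrite (@lead_rec_eq0 E k) ?mulr0 // occurs_word_of kE (negPf ks).
    rewrite add0r IH //; last first.
      apply: hs1 => //; last by rewrite mem_push mem_head.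
      by move=> q nq; rewrite mem_push inE (negPf nq).
    case: ifP => // _; apply: eq_bigl => q; rewrite mem_push /recurs /= !inE.
    by rewrite -/k; case: (q == k); rewrite ?orbT.
  move: close; rewrite negb_or => /andP[nk nE]; rewrite (negPf nk).
  rewrite [X in _ + X](@lead_rec_eq0 E k) ?addr0 //; last first.
    by rewrite occurs_word_of mem_push mem_head (negPf nE).
  rewrite -(word_of_cons (i := i)) // IH //; last by apply: hs1; rewrite // nk orbT.
  case: ifP => _; last by rewrite mulr0.
  rewrite [RHS](bigD1 k) /=; last by rewrite /recurs /= inE eqxx orbT.
  rewrite (negPf nE) block_of_catrev // bk; congr (_ * _); apply: eq_bigl => q.
  rewrite /recurs /= inE -/k; case: eqP => [->|] /=; rewrite ?andbT //.
  by rewrite (negPf ks) -[_ \in _]/(recurs col k l) (negPf nk).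
rewrite /= -/k occurs_word_of; case: (popP (chi i) s) => [es|q s' es].
  have ks : k \notin s by rewrite es.
  by have := ins ks; rewrite ks (negPf ks) es pop_nil.
have -> : pop (chi i) (word_of r s) = Some ((q, block_of r q), word_of r s').
  by rewrite es /word_of map_push push_pop.
rewrite /=; have [ek|nk] := eqVneq q k; last first.
  case: (boolP (k \in s)) => //= ks; exact: ins.
rewrite {q}ek in es *.
have [us' ks'] : uniq s' /\ k \notin s'.
  by move: us; rewrite es uniq_push => /andP[].
rewrite occurs_word_of ks' andbT.
have -> : push (chi i) (k, i :: block_of r k) (word_of r s') = word_of (i :: r) s.
  rewrite es /word_of map_push [block_of (i :: r) k]/= eqxx; congr push.
  exact/esym/word_of_cons.
have ks : k \in s by rewrite es mem_push mem_head.
have [stay|close] := boolP (recurs col k l || (k \in E)).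
  have -> : (if recurs col k l then 0
      else lp (i :: block_of r k) * lead_rec col chi lp (fin_on E) l (word_of r s')) = 0.
    move: stay; case: (boolP (recurs col k l)) => //= nk kE.
    by rewrite (@lead_rec_eq0 E k) ?mulr0 // occurs_word_of kE (negPf ks').
  rewrite add0r IH //; last by apply: hs1; rewrite // ks.
  case: ifP => // _; apply: eq_bigl => q; rewrite /recurs /= inE -/k.
  by case: eqP => // ->; rewrite ks.
move: close; rewrite negb_or => /andP[nk nE]; rewrite (negPf nk).
rewrite [X in _ + X](@lead_rec_eq0 E k) ?addr0 //; last first.
  by rewrite occurs_word_of ks (negPf nE).
rewrite -(word_of_cons (i := i)) // IH //; last first.
  apply: hs1; rewrite ?nk ?orbT // => q nq.
  by rewrite es mem_push inE (negPf nq).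
case: ifP => _; last by rewrite mulr0.
rewrite [RHS](bigD1 k) /=; last by rewrite ks.
rewrite (negPf nE) block_of_catrev // /= eqxx; congr (_ * _); apply: eq_bigl => q.
rewrite es mem_push /recurs /= !inE -/k; case: eqP => [->|] /=; rewrite ?andbT //.
by rewrite (negPf ks') -[_ \in _]/(recurs col k l) (negPf nk).
Qed.
End LeadingTerm.

(** * Feasible partitions are bi-non-crossing *)

Section Order.
Variables (n : nat) (chi : 'I_n -> face).
Local Notation lt := (chi_lt chi).

(** The smaller index precedes all larger ones if it is left and follows them all if it is right, so
    its face alone decides the comparison. *)
Lemma chi_lt_idx (i j : 'I_n) : (i < j)%N -> lt i j = Defs.is_left (chi i).
Proof. by rewrite /chi_lt; case: (chi i); case: (chi j) => //= h; lia. Qed.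

Lemma chi_lt_idxr (i j : 'I_n) : (i < j)%N -> lt j i = ~~ Defs.is_left (chi i).
Proof. by rewrite /chi_lt; case: (chi i); case: (chi j) => //= h; lia. Qed.

Lemma chi_ltxx : irreflexive lt.
Proof. by move=> i; rewrite /chi_lt; case: (chi i); rewrite ltnn. Qed.

Lemma chi_lt_trans : transitive lt.
Proof.
by move=> y x z; rewrite /chi_lt; case: (chi x); case: (chi y); case: (chi z) => //=; lia.
Qed.

Lemma chi_lt_total (i j : 'I_n) : i != j -> lt i j || lt j i.
Proof.
by rewrite -val_eqE /chi_lt; case: (chi i); case: (chi j) => //=; lia.
Qed.

Lemma chi_lt_asym (i j : 'I_n) : lt i j -> lt j i -> False.
Proof. by move=> h1 h2; have := chi_lt_trans h1 h2; rewrite chi_ltxx. Qed.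
End Order.

Section Feasibility.
Variables (n : nat) (chi : 'I_n -> face) (D : finType) (col : 'I_n -> D).
Local Notation lt := (chi_lt chi).
(** For a colour that occurs, this is its last index: the operator that acts first and opens the
    letter. *)
Variable op : D -> 'I_n.
Hypothesis col_op : forall i, col (op (col i)) = col i.
Hypothesis le_op : forall i : 'I_n, (i <= op (col i))%N.
Implicit Types (i u : 'I_n) (E : {set D}) (s : seq D).

Definition between x y z := (lt x y && lt y z) || (lt z y && lt y x).

(* The colour of i is hidden behind an open letter of colour col u when i is
   to act. *)
Definition blocked E i : bool :=
  [exists u, [&& u == op (col u), col u != col i, between i u (op (col i))
    & (col u \in E) || [exists v : 'I_n, (v < i)%N && (col v == col u)]]].

Let remaining k := rev (take k (enum 'I_n)).

Let recurs_remaining q k :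
  recurs col q (remaining k) = [exists v : 'I_n, (v < k)%N && (col v == q)].
Proof.
have mem_rem v : (v \in remaining k) = (v < k)%N.
  rewrite /remaining mem_rev -(mem_map val_inj) map_take val_enum_ord take_iota mem_iota /=.
  by have := ltn_ord v; lia.
apply/mapP/existsP => [[v hv ->]|[v /andP[hv /eqP <-]]]; exists v => //.
  by rewrite -mem_rem hv eqxx.
by rewrite mem_rem.
Qed.

(** The invariant once the indices from [k] on have acted: open letters are ordered by [chi_lt] of
    their openers. A new left opener precedes all earlier ones and a new right opener follows them,
    as [push] does. *)
Let state E k s :=
  pairwise (fun q q' => lt (op q) (op q')) s /\
  forall q, (q \in s) = [exists i : 'I_n, (k <= i)%N && (col i == q)]
                        && ((q \in E) || recurs col q (remaining k)).

Let state_op E k s q : state E k s -> q \in s -> (k <= op q)%N /\ col (op q) = q.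
Proof.
move=> [_ h]; rewrite h => /andP[/existsP[i /andP[ki /eqP <-]] _].
by split=> //; exact: leq_trans (le_op i).
Qed.

(** By the order of the openers, an open letter of colour [col i] is at the end reached by [i]
    unless another open letter has its opener between [i] and [op (col i)]. A colour of [E] must
    occur, or it would be missing from the final word. *)
Let feasible_remaining E k s : (k <= n)%N -> state E k s ->
  reflect ((forall i : 'I_n, (i < k)%N -> ~~ blocked E i) /\
           forall q, q \in E -> exists i, col i = q)
    (feasible col chi E (remaining k) s).
Proof.
elim: k s => [|k IH] s hk hs.
  rewrite /remaining take0 /=; apply: (iffP eqP) => [e|[_ hE]].
    split=> // q; rewrite -e inE => hq; exists (op q).
    exact: (state_op hs hq).2.
  apply/setP => q; rewrite inE hs.2; apply/andP/idP => [[_]|hq].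
    by rewrite /recurs /remaining take0 orbF.
  split; last by rewrite hq.
  by have [i <-] := hE q hq; apply/existsP; exists i; rewrite eqxx.
pose i := Ordinal hk.
have er : remaining k.+1 = i :: remaining k.
  rewrite /remaining (take_nth i) ?size_enum_ord // rev_rcons; congr (_ :: _).
  by apply: val_inj; rewrite /= nth_enum_ord.
have open q : q != col i -> (q \in s) = [exists j : 'I_n, (k <= j)%N && (col j == q)]
    && ((q \in E) || recurs col q (remaining k)).
  move=> nq; rewrite hs.2 er; congr (_ && _).
    apply/existsP/existsP => -[j /andP[kj ej]]; exists j; rewrite ej ?andbT //.
      exact: ltnW.
    rewrite ltn_neqAle kj andbT; apply: contra nq => /eqP e.
    by rewrite -(eqP ej); apply/eqP; congr col; apply: val_inj.
  by rewrite /recurs /= inE (negPf nq).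
have openi : (col i \in s) = (i < op (col i))%N.
  rewrite hs.2 er /recurs /= inE eqxx orbT andbT; apply/existsP/idP.
    by move=> [j /andP[kj /eqP <-]]; exact: leq_trans (le_op j).
  by move=> h; exists (op (col i)); rewrite h col_op eqxx.
have here : [exists j : 'I_n, (k <= j)%N && (col j == col i)].
  by apply/existsP; exists i; rewrite leqnn eqxx.
have split_blocked : ~~ blocked E i ->
  ((forall j : 'I_n, (j < k)%N -> ~~ blocked E j) /\ forall q, q \in E -> exists j, col j = q)
  <-> (forall j : 'I_n, (j < k.+1)%N -> ~~ blocked E j) /\ forall q, q \in E -> exists j, col j = q.
  move=> hi; split=> -[h1 h2]; split=> // j hj; last by apply: h1; exact: ltnW.
  have [e|ne] := eqVneq j i; first by rewrite e.
  by apply: h1; move: ne; rewrite -val_eqE /=; lia.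
have next s' : ~~ blocked E i -> state E k s' ->
    reflect ((forall j : 'I_n, (j < k.+1)%N -> ~~ blocked E j) /\
       forall q, q \in E -> exists j, col j = q)
      (feasible col chi E (remaining k) s').
  by move=> hi hs'; apply: (iffP (IH s' (ltnW hk) hs')); case: (split_blocked hi).
rewrite er /=; set stays := _ || _.
have insP : col i \notin s ->
  reflect ((forall j : 'I_n, (j < k.+1)%N -> ~~ blocked E j) /\
       forall q, q \in E -> exists j, col j = q)
  (feasible col chi E (remaining k) (if stays then push (chi i) (col i) s else s)).
  move=> his; have eo : op (col i) = i.
    by apply: val_inj; apply/eqP; rewrite eqn_leq le_op leqNgt -openi his.
  apply: next.
    (* Here [i] opens its own letter, and nothing lies strictly between [i] and itself. *)
    apply/existsP => -[u /and4P[_ _]]; rewrite eo /between.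
    by rewrite orbb => /andP[h1 h2] _; exact: chi_lt_asym h1 h2.
  split.
    case: ifP => // _; last exact: hs.1.
    rewrite pairwise_push hs.1 andbT; apply/allP => q /(state_op hs)[hq _].
    have := @chi_lt_idx n chi i _ hq; have := @chi_lt_idxr n chi i _ hq.
    by rewrite eo; case: (chi i).
  move=> q; have [->|nq] := eqVneq q (col i).
    rewrite here /= orbC -/stays; case: ifP => _; first by rewrite mem_push mem_head.
    exact/negbTE.
  by rewrite -open //; case: ifP => // _; rewrite mem_push inE (negPf nq).
case: (popP (chi i) s) => [es|q s' es].
  have his : col i \notin s by rewrite es.
  by rewrite his; exact: insP.
have [eq|nq] := eqVneq q (col i); last first.
  have [his|his] := boolP (col i \in s); last exact: insP.
  (* The letter of [col i] is open but another letter [q] is at the end; the opener of [q] witnesses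
     that [i] is blocked. *)
  apply: ReflectF => -[/(_ i (leqnn _)) /existsP[]].
  have hq : q \in s by rewrite es mem_push mem_head.
  have [kq cq] := state_op hs hq; exists (op q).
  have his' : col i \in s' by move: his; rewrite es mem_push inE eq_sym (negPf nq).
  move: hs.1; rewrite es pairwise_push => /andP[/allP /(_ _ his') hlt _].
  rewrite cq eqxx nq /=; apply/andP; split.
    have := @chi_lt_idx n chi i _ kq; have := @chi_lt_idxr n chi i _ kq.
    by rewrite /between; case: (chi i) hlt => /= -> -> ->; rewrite ?orbT.
  by move: hq; rewrite open // recurs_remaining => /andP[].
rewrite {q}eq in es; have his : col i \in s by rewrite es mem_push mem_head.
have io : (i < op (col i))%N by rewrite -openi.
have us : (col i \notin s') /\ pairwise (fun q q' => lt (op q) (op q')) s'.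
  move: hs.1; rewrite es pairwise_push => /andP[h ->]; split=> //.
  by apply/negP => /(allP h); case: (chi i); rewrite chi_ltxx.
apply: next.
  apply/existsP => -[u /and4P[/eqP eu nu hb hE]].
  (* An index below both [i] and [op (col i)] lies on the same side of both, so a blocking [u] has
     acted before [i]. *)
  have iu : (i < u)%N.
    have ne : u != i by apply: contraNneq nu => ->.
    case: (ltngtP i u) => // [ui|e]; last by case/eqP: ne; apply/val_inj/esym.
    move: hb; rewrite /between (chi_lt_idx _ ui) (chi_lt_idxr _ ui).
    rewrite (chi_lt_idx _ (ltn_trans ui io)) (chi_lt_idxr _ (ltn_trans ui io)).
    by case: Defs.is_left.
  have hu : col u \in s.
    by rewrite open // recurs_remaining hE andbT; apply/existsP; exists u; rewrite eqxx ltnW.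
  have hu' : col u \in s' by move: hu; rewrite es mem_push inE (negPf nu).
  move: hs.1; rewrite es pairwise_push => /andP[/allP /(_ _ hu') hlt _].
  rewrite -eu in hlt; move: hb; rewrite /between.
  rewrite (chi_lt_idx _ iu) (chi_lt_idxr _ iu).
  by case: (chi i) hlt => /= h; rewrite ?andbT ?andbF ?orbF => h'; exact: chi_lt_asym h h'.
split; first by case: ifP => _; [exact: hs.1 | exact: us.2].
move=> q; have [->|nq] := eqVneq q (col i).
  rewrite here /= orbC -/stays; case: ifP => _ //.
  exact/negbTE/us.1.
by rewrite -open //; case: ifP => // _; rewrite es mem_push inE (negPf nq).
Qed.

Lemma feasibleP E :
  reflect ((forall i, ~~ blocked E i) /\ forall q, q \in E -> exists i, col i = q)
    (feasible col chi E (rev (enum 'I_n)) [::]).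
Proof.
have h0 : state E n [::].
  split=> // q; apply/esym/negbTE; rewrite negb_and; apply/orP; left.
  by apply/existsP => -[j]; rewrite leqNgt ltn_ord.
have := feasible_remaining (leqnn n) h0.
rewrite {1}/remaining take_oversize ?size_enum_ord // => h.
apply: (iffP h) => -[h1 h2]; split=> // i; exact: h1.
Qed.

Definition no_crossing := forall a b c d, lt a b -> lt b c -> lt c d ->
  col a = col c -> col b = col d -> col a = col b.

(** Interiority of a block, phrased without minima and maxima; [interior_blockP] relates the two
    forms. *)
Definition enclosed q := exists a b : 'I_n, [/\ col a = col b, col a != q
  & forall u, col u = q -> lt a u /\ lt u b].

(** Indices are added downwards from [n]. The smallest one is extremal for [chi_lt], so it can only
    be an end point of a crossing; replacing it by the opener of its colour yields a crossing among
    larger indices or a blocked operator. *)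
Lemma unblocked_no_crossing E : (forall i, ~~ blocked E i) -> no_crossing.
Proof.
move=> nb; have lt_col x y : col x != col y -> lt x y || lt y x.
  by move=> h; apply: chi_lt_total; apply: contraNneq h => ->.
suff step k : forall a b c d : 'I_n, (k <= a)%N -> (k <= b)%N -> (k <= c)%N -> (k <= d)%N ->
    lt a b -> lt b c -> lt c d -> col a = col c -> col b = col d -> col a = col b.
  by move=> a b c d; apply: (step 0%N).
have [j ej] : exists j, j = (n - k)%N by exists (n - k)%N.
elim: j k ej => [|j IHj] k ej; first by move=> a; have := ltn_ord a; lia.
have {IHj}IH := IHj k.+1 (ltac:(lia)).
(* The smallest index [u] is the end point on either side. Its colour stays open until [u] acts, so
   its opener [m] blocks [v] or [v'] if it separates that one from the opener [o]. *)
have key (u v u' v' : 'I_n) : u = k :> nat -> (k < v)%N -> (k < u')%N -> (k < v')%N ->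
    lt v u' -> lt u' v' -> col v = col v' -> col u = col u' -> col u = col v.
  move=> eu kv ku' kv' vu' u'v' cv cu; apply/eqP; apply: contraT => ne.
  pose m := op (col u); pose o := op (col v).
  have cm : col m = col u := col_op u.
  have co : col o = col v := col_op v.
  have km : (k < m)%N by rewrite (leq_trans ku') // /m cu le_op.
  have mm : m == op (col m) by rewrite cm.
  have bad (x : 'I_n) : (k < x)%N -> col x = col v -> between x m o -> False.
    move=> kx cx hb; have /existsP[] := nb x; exists m.
    rewrite mm cx cm ne -/o hb /=; apply/orP; right.
    by apply/existsP; exists u; rewrite eu kx eqxx.
  have /orP[vm|mv] := lt_col v m ltac:(by rewrite cm eq_sym).
    have /orP[mv'|v'm] := lt_col m v' ltac:(by rewrite cm -cv).
      have /orP[om|mo] := lt_col o m ltac:(by rewrite cm co eq_sym).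
        by case: (bad v') => //; rewrite /between om mv' orbT.
      by case: (bad v) => //; rewrite /between vm mo.
    have := IH v u' v' m kv ku' kv' km vu' u'v' v'm cv.
    by rewrite cm => /(_ (esym cu)) e; rewrite e cu eqxx in ne.
  have := IH m v u' v' km kv ku' kv' mv vu' u'v'.
  by rewrite cm => /(_ cu cv) e; rewrite e eqxx in ne.
move=> a b c d ka kb kc kd ab bc cd cac cbd.
have neq (x y : 'I_n) : lt x y -> x = y :> nat -> False.
  by move=> h /val_inj e; rewrite e chi_ltxx in h.
have hb : (k < b)%N.
  rewrite ltn_neqAle kb andbT; apply/eqP => e.
  have h1 : (b < a)%N
    by rewrite ltn_neqAle -e ka andbT; apply/eqP => /esym h; apply: (neq _ _ ab); rewrite h -e.
  have h2 : (b < c)%N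
    by rewrite ltn_neqAle -e kc andbT; apply/eqP => h; apply: (neq _ _ bc); rewrite -h -e.
  by move: ab bc; rewrite (chi_lt_idx _ h2) (chi_lt_idxr _ h1) => /negP.
have hc : (k < c)%N.
  rewrite ltn_neqAle kc andbT; apply/eqP => e.
  have h1 : (c < b)%N by rewrite -e.
  have h2 : (c < d)%N
    by rewrite ltn_neqAle -e kd andbT; apply/eqP => h; apply: (neq _ _ cd); rewrite -h -e.
  by move: bc cd; rewrite (chi_lt_idx _ h2) (chi_lt_idxr _ h1) => /negP.
have [ea|na] := eqVneq (a : nat) k.
  have [ed|nd] := eqVneq (d : nat) k.
    by case: (neq a d); rewrite ?ed // (chi_lt_trans ab) // (chi_lt_trans bc).
  by apply: (key a b c d) => //; lia.
have [ed|nd] := eqVneq (d : nat) k; last by apply: (IH a b c d) => //; lia.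
by have := key d a b c ed ltac:(lia) hb hc ab bc cac (esym cbd); rewrite -cbd.
Qed.

(** For the converse, a blocking [u] lies between two operators [a] and [b] of colour [col i], and
    without crossings so does its whole colour. It is then enclosed, hence not in [E]; and an
    operator [v] of it acting after [i] would be on the same side of [a] and [b]. *)
Lemma unblockedP E : (forall i, ~~ blocked E i) <->
  no_crossing /\ (forall i, col i \in E -> ~ enclosed (col i)).
Proof.
have lt_col x y : col x != col y -> lt x y || lt y x.
  by move=> h; apply: chi_lt_total; apply: contraNneq h => ->.
split=> [nb|[nc ext] i].
  split; first exact: unblocked_no_crossing nb.
  move=> i iE [a [b [cab ca hab]]].
  pose m := op (col i); pose o := op (col a).
  have cm : col m = col i := col_op i.
  have co : col o = col a := col_op a.
  have [am mb] := hab m cm.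
  have bad x : col x = col a -> between x m o -> False.
    move=> cx hb; have /existsP[] := nb x; exists m.
    by rewrite cm eqxx cx eq_sym ca -/o hb iE.
  have /orP[om|mo] := lt_col o m ltac:(by rewrite cm co).
    by apply: (bad b) => //; rewrite /between om mb orbT.
  by apply: (bad a) => //; rewrite /between am mo.
apply/existsP => -[u /and4P[/eqP eu nu hb]].
pose o := op (col i); have co : col o = col i := col_op i.
have [a [b [ca cb au ub ho]]] : exists a b,
    [/\ col a = col i, col b = col i, lt a u, lt u b
      & forall v, lt v i = lt v o -> lt i v = lt o v -> lt v a = lt v b /\ lt a v = lt b v].
  case/orP: hb => /andP[h1 h2]; [exists i, o | exists o, i]; split=> //.
have nc1 v : col v = col u -> ~ lt v a.
  move=> cv va; have := nc _ _ _ _ va au ub cv; rewrite ca cb => /(_ erefl) e.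
  by rewrite -e cv eqxx in nu.
have nc2 v : col v = col u -> ~ lt b v.
  move=> cv bv; have := nc _ _ _ _ au ub bv; rewrite ca cb cv => /(_ erefl erefl) e.
  by rewrite -e eqxx in nu.
case/orP => [uE|/existsP[v /andP[vi /eqP cv]]].
  apply: (ext u uE); exists a, b; split=> [||v cv]; rewrite ?ca ?cb // 1?eq_sym //.
  have /orP[?|?] := lt_col v a ltac:(by rewrite cv ca); first by case: (nc1 v).
  have /orP[?|?] := lt_col v b ltac:(by rewrite cv cb); first by [].
  by case: (nc2 v).
have vo : (v < o)%N := leq_trans vi (le_op i).
have [e1 e2] : lt v a = lt v b /\ lt a v = lt b v.
  by apply: ho; rewrite ?(chi_lt_idx _ vi) ?(chi_lt_idx _ vo)
    ?(chi_lt_idxr _ vi) ?(chi_lt_idxr _ vo).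
have /orP[?|av] := lt_col v a ltac:(by rewrite cv ca); first by case: (nc1 v).
by apply: (nc2 v cv); rewrite -e2.
Qed.
End Feasibility.

(** * Set partitions, with the blocks as colours *)

Section Blocks.
Variables (n : nat) (chi : 'I_n -> face) (P : {set {set 'I_n}}).
Hypothesis partP : finset.partition P [set: 'I_n].
Local Notation lt := (chi_lt chi).
Local Notation col := (finset.pblock P).

Let trivP : finset.trivIset P. Proof. by case/and3P: partP. Qed.
Let coverP (i : 'I_n) : i \in finset.cover P.
Proof. by case/and3P: partP => /eqP ->; rewrite inE. Qed.

Lemma pblock_eqE V (i : 'I_n) : V \in P -> (finset.pblock P i == V) = (i \in V).
Proof.
move=> VP; apply/eqP/idP => [<-|]; first by rewrite finset.mem_pblock.
exact: finset.def_pblock.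
Qed.

Lemma block_nonempty V : V \in P -> exists i, i \in V.
Proof.
move=> VP; apply/finset.set0Pn; case/and3P: partP => _ _; apply: contra.
by move/eqP <-.
Qed.

Lemma noncrossingP : reflect (no_crossing chi col) (noncrossing chi P).
Proof.
apply: (iffP forall_inP) => [h a b c d ab bc cd ac bd|h V VP].
  apply/eqP; apply: contraT => ne.
  have := forall_inP (h _ (finset.pblock_mem (coverP a))) _ (finset.pblock_mem (coverP b)).
  rewrite ne /= => /negP[]; apply/exists_inP; exists a; first by rewrite finset.mem_pblock.
  apply/exists_inP; exists b; first by rewrite finset.mem_pblock.
  apply/exists_inP; exists c; first by rewrite ac finset.mem_pblock.
  apply/exists_inP; exists d; first by rewrite bd finset.mem_pblock.
  by rewrite ab bc cd.
apply/forall_inP => W WP; apply/implyP => ne; apply: contra ne.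
case/exists_inP => a; rewrite -pblock_eqE // => /eqP aV.
case/exists_inP => b; rewrite -pblock_eqE // => /eqP bW.
case/exists_inP => c; rewrite -pblock_eqE // => /eqP cV.
case/exists_inP => d; rewrite -pblock_eqE // => /eqP dW.
case/and3P => ab bc cd; rewrite -aV -bW; apply/eqP.
by apply: (h a b c d) => //; rewrite ?aV ?cV ?bW ?dW.
Qed.

Lemma chi_minP (V : {set 'I_n}) i0 : i0 \in V -> exists i, is_chi_min chi V i.
Proof.
move=> i0V; have [i iV imin] :=
  @arg_minnP _ i0 (fun i => i \in V) (fun i => #|[pred j in V | lt j i]|) i0V.
exists i; rewrite /is_chi_min iV; apply/forall_inP => j jV.
have [//|ne] := eqVneq j i; have /orP[ji|//] := chi_lt_total chi ne.
have := imin j jV; rewrite leqNgt => /negP[]; apply: proper_card; apply/properP; split.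
  apply/fintype.subsetP => k; rewrite !inE => /andP[-> kj]; exact: chi_lt_trans kj ji.
by exists j; rewrite !inE jV ?ji // chi_ltxx.
Qed.

Lemma chi_maxP (V : {set 'I_n}) i0 : i0 \in V -> exists i, is_chi_max chi V i.
Proof.
move=> i0V; have [i iV imin] :=
  @arg_minnP _ i0 (fun i => i \in V) (fun i => #|[pred j in V | lt i j]|) i0V.
exists i; rewrite /is_chi_max iV; apply/forall_inP => j jV.
have [//|ne] := eqVneq j i; have /orP[//|ji] := chi_lt_total chi ne.
have := imin j jV; rewrite leqNgt => /negP[]; apply: proper_card; apply/properP; split.
  apply/fintype.subsetP => k; rewrite !inE => /andP[-> kj]; exact: chi_lt_trans ji kj.
by exists j; rewrite !inE jV ?ji // chi_ltxx.
Qed.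

Lemma interior_blockP V : V \in P ->
  reflect (enclosed chi col V) (interior_block chi P V).
Proof.
move=> VP; apply: (iffP exists_inP) => [[W WP]|[a [b [cab ca hV]]]].
  case/andP => /andP[ne /existsP[a /existsP[x /and3P[/andP[aW _] /andP[_ /forall_inP xmin] ax]]]].
  case/existsP => y /existsP[b /and3P[/andP[_ /forall_inP ymax] /andP[bW _] yb]].
  move: aW bW; rewrite -!pblock_eqE // => /eqP aW /eqP bW.
  exists a, b; split=> [||u /eqP]; rewrite ?aW ?bW // pblock_eqE // => uV; split.
    by case/orP: (xmin u uV) => [/eqP -> //|]; exact: chi_lt_trans.
  by case/orP: (ymax u uV) => [/eqP -> //| h]; exact: chi_lt_trans h yb.
have [i0 i0V] := block_nonempty VP.
have aW : a \in col a by rewrite finset.mem_pblock.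
have bW : b \in col a by rewrite cab finset.mem_pblock.
have hV' u : u \in V -> lt a u /\ lt u b by rewrite -pblock_eqE // => /eqP; exact: hV.
exists (col a); first exact: finset.pblock_mem.
rewrite ca /=; have [x hx] := chi_minP aW; have [y hy] := chi_maxP aW.
have [x' hx'] := chi_minP i0V; have [y' hy'] := chi_maxP i0V.
have x'V : x' \in V by case/andP: hx'.
have y'V : y' \in V by case/andP: hy'.
apply/andP; split.
  apply/existsP; exists x; apply/existsP; exists x'; rewrite hx hx' /=.
  case/andP: hx => _ /forall_inP/(_ a aW)/orP[/eqP <-|xa]; first exact: (hV' _ x'V).1.
  exact: chi_lt_trans xa (hV' _ x'V).1.
apply/existsP; exists y'; apply/existsP; exists y; rewrite hy hy' /=.
case/andP: hy => _ /forall_inP/(_ b bW)/orP[/eqP <-|yb]; first exact: (hV' _ y'V).2.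
exact: chi_lt_trans (hV' _ y'V).2 yb.
Qed.

Let exterior := [set V in P | ~~ interior_block chi P V].

Lemma feasible_blocks E : (0 < n)%N ->
  feasible col chi E (rev (enum 'I_n)) [::]
  = noncrossing chi P && (E \subset exterior).
Proof.
(* The opener is the largest index of the block; the default value serves the empty set, which is
   not a block. *)
move=> n0; pose op (V : {set 'I_n}) := if [pick i in V] is Some i
  then [arg max_(j > i in V) nat_of_ord j] else Ordinal n0.
have opP (V : {set 'I_n}) (i : 'I_n) : i \in V -> op V \in V /\ (i <= op V)%N.
  move=> iV; rewrite /op; case: pickP => [j jV|/(_ i)]; last by rewrite iV.
  by case: arg_maxnP => // k kV kmax; split=> //; exact: kmax.
have col_op i : col (op (col i)) = col i.
  apply: finset.def_pblock; rewrite ?finset.pblock_mem //.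
  by apply: (opP _ i _).1; rewrite finset.mem_pblock.
have le_op (i : 'I_n) : (i <= op (col i))%N by apply: (opP _ i _).2; rewrite finset.mem_pblock.
apply/(feasibleP chi col_op le_op)/andP.
  case=> /(unblockedP chi col_op le_op)[nc ext] hE; split; first exact/noncrossingP.
  apply/fintype.subsetP => V VE; have [i ei] := hE V VE.
  have VP : V \in P by rewrite -ei finset.pblock_mem.
  rewrite inE VP; apply/negP => /(interior_blockP VP); rewrite -ei; apply: ext.
  by rewrite ei.
case=> /noncrossingP nc /fintype.subsetP hE; split.
  apply/(unblockedP chi col_op le_op); split=> // i /hE.
  rewrite inE => /andP[VP]; move/negP => h1 h2; apply: h1; exact/interior_blockP.
move=> V /hE; rewrite inE => /andP[VP _]; have [i iV] := block_nonempty VP.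
by exists i; apply/eqP; rewrite pblock_eqE.
Qed.

Lemma recurs_enum V : recurs col V (rev (enum 'I_n)) = (V \in P).
Proof.
apply/mapP/idP => [[i _ ->]|VP]; first exact: finset.pblock_mem.
have [i iV] := block_nonempty VP; exists i; first by rewrite mem_rev mem_enum.
by apply/esym/eqP; rewrite pblock_eqE.
Qed.

Section Lead.
Variables (C : comNzRingType) (lp lq : seq 'I_n -> C).
Hypothesis n_gt0 : (0 < n)%N.

Lemma lead_rec_blocks (g : seq 'I_n -> C) E :
  lead_rec col chi lp (fin_on g E) (rev (enum 'I_n)) [::]
  = if noncrossing chi P && (E \subset exterior) then
      \prod_(V in P) (if V \in E then g else lp) (enum V)
    else 0.
Proof.
have := @lead_rec_feasible _ _ _ col chi lp g E (rev (enum 'I_n)) [::] [::] isT.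
rewrite feasible_blocks // => -> //; case: ifP => // _.
apply: eq_big => [V|V]; first by rewrite recurs_enum.
rewrite recurs_enum /= => VP; congr ((if _ then g else lp) _).
rewrite -[catrev _ _]/(rev _) revK /block_of [in RHS]/(enum _).
rewrite enumT; apply: eq_filter => j; exact: pblock_eqE.
Qed.

(** Only the empty word has nonzero [psi], so every block has to be closed: [E] is empty. *)
Lemma lead_rec_psi :
  lead_rec col chi lp (fun w => (nilp w)%:R) (rev (enum 'I_n)) [::]
  = if noncrossing chi P then \prod_(V in P) lp (enum V) else 0.
Proof.
transitivity (lead_rec col chi lp (fin_on lp finset.set0) (rev (enum 'I_n)) [::]).
  congr lead_rec; apply: funext => -[|x w]; rewrite /fin_on /=.
    rewrite big_nil ifT //; apply/eqP/setP => q; by rewrite !inE.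
  case: eqP => // /setP/(_ x.1); by rewrite !inE /occurs /= inE eqxx.
rewrite lead_rec_blocks finset.sub0set andbT; case: ifP => // _.
by apply: eq_bigr => V _; rewrite inE.
Qed.

(* Expanding lq V = (lq V - lp V) + lp V over the exterior blocks gives the
   sum over the sets of blocks which are left open. *)
Lemma lead_rec_phi :
  lead_rec col chi lp (fun w => \prod_(x <- w) (lq x.2 - lp x.2)) (rev (enum 'I_n)) [::]
  = if noncrossing chi P then
      (\prod_(V in P | interior_block chi P V) lp (enum V)) *
      (\prod_(V in P | ~~ interior_block chi P V) lq (enum V))
    else 0.
Proof.
pose g V := lq V - lp V.
transitivity (\sum_(E : {set {set 'I_n}}) lead_rec col chi lp (fin_on g E) (rev (enum 'I_n)) [::]).
  rewrite -lead_rec_sum; congr lead_rec; apply: funext => w.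
  by rewrite /fin_on -big_mkcond /= (big_pred1 [set q | occurs q w]) // => E; rewrite eq_sym.
rewrite (eq_bigr _ (fun E _ => lead_rec_blocks g E)).
case: ifP => nc /=; last by rewrite big1.
(* The value 0 off the exterior blocks removes the sets [E] not contained in them, so the sum may
   run over all sets; likewise [G] is 1 off [P]. *)
pose F V := if V \in exterior then g (enum V) else 0.
pose G V := if V \in P then lp (enum V) else 1.
transitivity (\sum_(E : {set {set 'I_n}}) \prod_V (if V \in E then F V else G V)).
  apply: eq_bigr => E _; case: (boolP (E \subset exterior)) => hE.
    rewrite big_mkcond /=; apply: eq_bigr => V _; rewrite /F /G.
    case: (boolP (V \in E)) => // VE; have Vx := fintype.subsetP hE V VE.
    by rewrite Vx; move: Vx; rewrite inE => /andP[-> _].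
  case/fintype.subsetPn: hE => V VE /negPf Vx.
  by rewrite (bigD1 V) //= VE /F Vx mul0r.
rewrite -bigA_distr (bigID (mem P)) /= [X in _ * X]big1 ?mulr1; last first.
  by move=> V /negPf VP; rewrite /F /G inE VP add0r.
rewrite (bigID (interior_block chi P)) /=; congr (_ * _); apply: eq_bigr => V /andP[VP VI].
  by rewrite /F /G inE VP VI add0r.
by rewrite /F /G inE VP VI /g subrK.
Qed.
End Lead.
End Blocks.

(** * Moments of c-bi-free families *)

Section FreeOperators.
Variables (C : fieldType) (K : choiceType) (X : K -> two_state_space C).
Local Notation word := (word X).
Implicit Types (w : word) (f : face) (k : K).

Definition free_end f k w := if f is Left then left_free k w else right_free k w.

Lemma reduced_push f (q : {k : K & X k}) w :
  reduced (push f q w)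
  = [&& tss_psi (X (tag q)) (tagged q) == 0, reduced w & free_end f (tag q) w].
Proof.
case: f => /=; first exact: reduced_cons.
by rewrite -reduced_rev rev_rcons reduced_cons reduced_rev.
Qed.

Lemma free_end_push f k q w : free_end f k (push f q w) = (tag q != k).
Proof. by case: f => //=; rewrite /right_free rev_rcons. Qed.

Lemma free_end_nil f k : free_end f k ([::] : word).
Proof. by case: f. Qed.

Lemma tensor_push_linear f k w (c : C) (x y : X k) :
  reduced (push f (letter x) w) -> reduced (push f (letter y) w) ->
  tensor (push f (letter (c *: x + y)) w)
  = c *: tensor (push f (letter x) w) + tensor (push f (letter y) w).
Proof.
case: f => /=; first exact: (tensor_multilinear (u := [::])).
by rewrite -!cats1; exact: tensor_multilinear.
Qed.

Lemma free_op_push f k (T : {linear X k -> X k}) (x : X k) w :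
  reduced (push f (letter x) w) ->
  free_op f T (tensor (push f (letter x) w))
  = tss_psi (X k) (T x) *: tensor w + tensor (push f (letter (circ (T x))) w).
Proof.
case: f => /= h.
  by apply: (etrans (lambda_tensor T h)); rewrite /lambda_word Vinv_letter.
by apply: (etrans (rho_tensor T h)); rewrite /rho_word Winv_letter.
Qed.

Lemma free_op_free f k (T : {linear X k -> X k}) w :
  reduced w -> free_end f k w ->
  free_op f T (tensor w)
  = tss_psi (X k) (T (tss_xi (X k))) *: tensor w
    + tensor (push f (letter (circ (T (tss_xi (X k))))) w).
Proof.
case: f => /= h h'.
  by apply: (etrans (lambda_tensor T h)); rewrite /lambda_word Vinv_free.
by apply: (etrans (rho_tensor T h)); rewrite /rho_word Winv_free.
Qed.

End FreeOperators.

Section Run.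
Variables (C : fieldType) (K : choiceType) (X : K -> two_state_space C).
Local Notation word := (word X).
Variables (T : eqType) (D : finType) (col : T -> D) (chi : T -> face).
Variables (act : forall k : K, T -> {linear X k -> X k}) (pick_col : D -> K).
Hypothesis pick_inj : forall i j, pick_col (col i) = pick_col (col j) -> col i = col j.

Definition vec (k : K) (V : seq T) : X k := foldr (fun i v => act k i v) (tss_xi (X k)) V.

Definition realize (w : seq (D * seq T)) : word :=
  [seq letter (circ (vec (pick_col x.1) x.2)) | x <- w].

Definition run (l : seq T) (v : cfree_space X) : cfree_space X :=
  foldl (fun v i => free_op (chi i) (act (pick_col (col i)) i) v) v l.

Lemma run_linear l (c : C) (u v : cfree_space X) :
  run l (c *: u + v) = c *: run l u + run l v.
Proof. by elim: l u v => //= i l IH u v; rewrite linearP IH. Qed.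

Variables (p : seq T -> C) (fin : seq (D * seq T) -> C) (F : {scalar cfree_space X}).
Hypothesis psi_vec : forall i V, tss_psi (X (pick_col (col i))) (vec (pick_col (col i)) V) = p V.
(** Distinct colours are known to have distinct spaces only in the image of [col], hence the
    restriction on letters. *)
Let colored (w : seq (D * seq T)) := forall x, x \in w -> exists i, col i = x.1.
Hypothesis F_realize : forall w, colored w -> reduced (realize w) -> F (tensor (realize w)) = fin w.

(** Splitting each vector into a multiple of the state-vector and its [circ] part turns the action
    of one operator into the branches of [val_rec]. *)
Lemma run_val_rec l w : colored w -> reduced (realize w) ->
  F (run l (tensor (realize w))) = val_rec col chi p fin l w.
Proof.
elim: l w => [|i l IH] w cw rw; first exact: F_realize.
set k := col i; set kk := pick_col k.
have circ_psi (x : X kk) : tss_psi (X kk) (circ x) == 0 by rewrite circ_ker.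
have cpush V w1 : colored w1 -> colored (push (chi i) (k, V) w1).
  by move=> h x; rewrite mem_push inE => /orP[/eqP -> |/h //]; exists i.
have rpush V w1 : reduced (realize w1) -> free_end (chi i) kk (realize w1) ->
    reduced (realize (push (chi i) (k, V) w1)).
  by move=> h1 h2; rewrite /realize map_push reduced_push /= circ_psi h1.
have psi1 V : tss_psi (X kk) (vec kk V) = p V by exact: psi_vec.
have ins w1 : colored w1 -> reduced (realize w1) -> free_end (chi i) kk (realize w1) ->
    F (run (i :: l) (tensor (realize w1)))
    = p [:: i] * val_rec col chi p fin l w1
      + val_rec col chi p fin l (push (chi i) (k, [:: i]) w1).
  move=> c1 r1 f1; rewrite /= free_op_free //.
  rewrite -[act _ i (tss_xi _)]/(vec kk [:: i]) run_linear linearP psi1 IH //.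
  congr (_ + _); rewrite -IH; [|exact: cpush|exact: rpush].
  by rewrite /realize map_push.
have cw' x w' : w = push (chi i) x w' -> colored w'.
  by move=> ew y hy; apply: cw; rewrite ew mem_push inE hy orbT.
rewrite [RHS]/= -/k; case: popP => [ew|x w' ew].
  by apply: ins => //; rewrite ew; exact: free_end_nil.
have [ex|nx] := eqVneq x.1 k; last first.
  apply: ins => //; rewrite ew /realize map_push free_end_push /=.
  apply: contra nx => /eqP; have [j <-] : exists j, col j = x.1.
    by apply: cw; rewrite ew mem_push mem_head.
  by move/pick_inj/eqP.
case: x ex ew => _ V /= -> ew; have {}cw' := cw' _ _ ew.
move: rw; rewrite {w cw}ew /realize map_push /= -/kk => rw.
move: (rw); rewrite reduced_push /= => /and3P[_ r' f'].
rewrite free_op_push //.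
(* The correction inside [circ] is the source of the negative term of [val_rec]. *)
have -> : act kk i (circ (vec kk V)) = (- p V) *: vec kk [:: i] + vec kk (i :: V).
  by rewrite linearB linearZ /= psi1 addrC scaleNr.
rewrite circ_linear tensor_push_linear; first last.
- by rewrite reduced_push /= circ_psi r'.
- by rewrite reduced_push /= circ_psi r'.
rewrite run_linear run_linear !linearP !psi1.
have hV V' : F (run l (tensor (push (chi i) (letter (circ (vec kk V'))) (realize w'))))
    = val_rec col chi p fin l (push (chi i) (k, V') w').
  by rewrite -IH; [rewrite /realize map_push | exact: cpush | exact: rpush].
rewrite -/(realize w') !hV IH //.
by ring.
Qed.
End Run.

Lemma psi_tensor (C : fieldType) (K : choiceType) (X : K -> two_state_space C) (w : word X) :
  reduced w -> tss_psi (cfree_space X) (tensor w) = (nilp w)%:R.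
Proof. exact: (cfree_liftE (@psi_word_multilinear _ _ X)). Qed.

Lemma phi_tensor (C : fieldType) (K : choiceType) (X : K -> two_state_space C) (w : word X) :
  reduced w ->
  tss_phi (cfree_space X) (tensor w) = \prod_(q <- w) tss_phi (X (tag q)) (tagged q).
Proof. exact: (cfree_liftE (@phi_word_multilinear _ _ X)). Qed.

Section FamilyMoments.
Variables (C : fieldType) (I J : Type) (A : two_state_ncps C) (K : choiceType).
Variable a : K -> I + J -> A.
Hypothesis free_a : c_bi_free_families a.

Definition psi_moment (k : K) (v : seq (I + J)) : C := ncps_psi A (\prod_(x <- v) a k x).
Definition phi_moment (k : K) (v : seq (I + J)) : C := ncps_phi A (\prod_(x <- v) a k x).

Variables (T : eqType) (D : finType) (col : T -> D) (alpha : T -> I + J).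
Variables (k : T -> K) (pick_col : D -> K) (k0 : K).
Hypothesis pick_colK : forall i, pick_col (col i) = k i.
Hypothesis col_inj : forall i j, k i = k j -> col i = col j.
Hypothesis same_psi : forall k k' v, psi_moment k v = psi_moment k' v.
Hypothesis same_phi : forall k k' v, phi_moment k v = phi_moment k' v.
Local Notation chi := (fun i => face_of (alpha i)).

Lemma face_algebra_gen (B : algType C) (b : I + J -> B) x :
  face_algebra b (face_of x) (b x).
Proof. by move=> S [_ hS]; apply: hS; exists x. Qed.

(** In the operator model both [p] and [fin] reduce to moments of single families, which agree for
    all families; so a mixed moment depends on the choice of families only through [col]. *)
Lemma mixed_moments l :
  ncps_psi A (\prod_(s <- l) a (k s) (alpha s))
    = val_rec col chi (fun V => psi_moment k0 (map alpha V)) (fun w => (nilp w)%:R)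
        (rev l) [::] /\
  ncps_phi A (\prod_(s <- l) a (k s) (alpha s))
    = val_rec col chi (fun V => psi_moment k0 (map alpha V))
        (fun w => \prod_(x <- w)
           (phi_moment k0 (map alpha x.2) - psi_moment k0 (map alpha x.2)))
        (rev l) [::].
Proof.
have [X [h [_ hX]]] := free_a.
pose act q i : {linear X q -> X q} := h q (chi i) (a q (alpha i)).
have eval (c : T -> K) l1 :
    let v := foldr (fun i => free_op (chi i) (act (c i) i)) (tss_xi (cfree_space X)) l1 in
    ncps_phi A (\prod_(s <- l1) a (c s) (alpha s)) = tss_phi (cfree_space X) v /\
    ncps_psi A (\prod_(s <- l1) a (c s) (alpha s)) = tss_psi (cfree_space X) v.
  have := hX [seq (c s, chi s, a (c s) (alpha s)) | s <- l1].
  rewrite !big_map foldr_map => e; apply: e => q f x /mapP[s _ [-> -> ->]].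
  exact: face_algebra_gen.
(* One family alone moves the state-vector inside the copy of [X q], where both faces act as on
   [X q] itself. This identifies [psi] and [phi] of [vec] with moments in [A]. *)
have single q V : V != [::] ->
    foldr (fun i => free_op (chi i) (act q i)) (tss_xi (cfree_space X)) V
    = Vmap (vec act q V) [::].
  have start i : free_op (chi i) (act q i) (tensor [::]) = Vmap (act q i (tss_xi (X q))) [::].
    by rewrite free_op_free ?free_end_nil // /Vmap; case: (chi i).
  elim: V => // i [|j V] IH _; first exact: start.
  have e := IH isT; rewrite /= in e *; rewrite e.
  case: (chi i) => /=; first exact: (@lambdaE _ _ _ _ _ _ [::]).
  exact: (@rhoE _ _ _ _ _ _ [::]).
have red1 q (x : X q) : reduced [:: letter (circ x)].
  by rewrite reduced_cons /= circ_ker eqxx.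
have psi_Vmap q (x : X q) : tss_psi (cfree_space X) (Vmap x [::]) = tss_psi (X q) x.
  rewrite /Vmap linearP !psi_tensor //=.
  by rewrite addr0 mulr1.
have phi_circ q (x : X q) : tss_phi (X q) (circ x) = tss_phi (X q) x - tss_psi (X q) x.
  by rewrite /circ linearB linearZ /= tss_phi_xi mulr1.
have phi_Vmap q (x : X q) : tss_phi (cfree_space X) (Vmap x [::]) = tss_phi (X q) x.
  rewrite /Vmap linearP !phi_tensor //.
  by rewrite big_nil big_cons big_nil /= !mulr1 phi_circ addrC subrK.
have psi_vec q V : tss_psi (X q) (vec act q V) = psi_moment k0 (map alpha V).
  rewrite (same_psi k0 q) /psi_moment big_map; case: V => [|i V].
    by rewrite big_nil ncps_psi1 tss_psi_xi.
  by rewrite (eval (fun=> q) (i :: V)).2 single // psi_Vmap.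
have phi_vec q V : tss_phi (X q) (vec act q V) = phi_moment k0 (map alpha V).
  rewrite (same_phi k0 q) /phi_moment big_map; case: V => [|i V].
    by rewrite big_nil ncps_phi1 tss_phi_xi.
  by rewrite (eval (fun=> q) (i :: V)).1 single // phi_Vmap.
have pinj i j : pick_col (col i) = pick_col (col j) -> col i = col j.
  by rewrite !pick_colK; exact: col_inj.
have runE : foldr (fun i => free_op (chi i) (act (k i) i)) (tss_xi (cfree_space X)) l
    = run col chi act pick_col (rev l) (tensor (realize act pick_col [::])).
  rewrite /run foldl_rev /=; elim: l => //= i l ->.
  by rewrite pick_colK.
split.
  rewrite (eval k l).2 runE; apply: run_val_rec => // w _ rw.
  by rewrite psi_tensor //; case: w {rw}.
rewrite (eval k l).1 runE; apply: run_val_rec => // w _ rw.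
rewrite phi_tensor // big_map.
by apply: eq_bigr => x _ /=; rewrite phi_circ psi_vec phi_vec.
Qed.
End FamilyMoments.

(** * Colourings grouped by their kernel *)

Section Kernel.
Variables (S T : finType).
Implicit Types (k : {ffun S -> T}) (P : {set {set S}}).

Definition kernel k := finset.preim_partition k [set: S].

Lemma kernel_partition k : finset.partition (kernel k) [set: S].
Proof. exact: preim_partitionP. Qed.

Lemma pblock_kernel k i j :
  (finset.pblock (kernel k) i == finset.pblock (kernel k) j) = (k i == k j).
Proof.
have /and3P[/eqP cov triv _] := kernel_partition k.
rewrite finset.eq_pblock // ?cov ?inE // /kernel /finset.preim_partition.
rewrite finset.pblock_equivalence_partition ?inE //.
by split=> [|/eqP ->]; rewrite ?eqxx.
Qed.

(** A map with kernel [P] is the same as an injection from the blocks of [P], which [F] composes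
    with the block map. *)
Lemma card_kernel P : finset.partition P [set: S] ->
  #|[set k | kernel k == P]| = (#|T| ^_ #|P|)%N.
Proof.
move=> partP; have /and3P[/eqP cov triv P0] := partP.
have inP i : finset.pblock P i \in P by rewrite finset.pblock_mem // cov inE.
pose F (g : {ffun {V | V \in P} -> T}) : {ffun S -> T} :=
  [ffun i => g (exist _ (finset.pblock P i) (inP i))].
have FK (g : {ffun {V | V \in P} -> T}) (V : {V | V \in P}) i :
    i \in val V -> F g i = g V.
  move=> iV; rewrite ffunE; congr (g _); apply: val_inj => /=.
  by rewrite (finset.def_pblock triv (valP V)).
have ne (V : {V | V \in P}) : exists i, i \in val V.
  by apply/finset.set0Pn; apply: contraNneq P0 => <-; exact: valP.
have Finj : injective F.
  move=> g1 g2 e; apply/ffunP => V; have [i iV] := ne V.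
  by rewrite -!(FK _ _ i iV) e.
rewrite -(card_sig (mem P)) -card_inj_ffuns -(card_imset _ Finj).
apply: eq_card => k; rewrite inE; apply/eqP/imsetP => [ek|[g]].
  have kK i j : j \in finset.pblock P i -> k j = k i.
    move=> ji; apply/eqP; rewrite -pblock_kernel ek.
    by rewrite (finset.def_pblock triv (inP i) ji).
  pose e V := xchoose (ne V); have eP V : e V \in val V := xchooseP (ne V).
  pose g : {ffun {V | V \in P} -> T} := [ffun V => k (e V)].
  have gE i : g (exist _ (finset.pblock P i) (inP i)) = k i.
    by rewrite ffunE; apply: kK; exact: eP.
  have FgE i : F g i = k i by rewrite ffunE gE.
  exists g; last by apply/ffunP => i; rewrite FgE.
  rewrite inE; apply/injectiveP => V W.
  have [i iV] := ne V; have [j jW] := ne W.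
  rewrite -(FK g V i iV) -(FK g W j jW) !FgE => /eqP.
  rewrite -pblock_kernel ek (finset.def_pblock triv (valP V) iV).
  by rewrite (finset.def_pblock triv (valP W) jW) => /eqP; exact: val_inj.
rewrite inE => /injectiveP ginj ->.
rewrite -(finset.equivalence_partition_pblock partP) /kernel /finset.preim_partition.
rewrite /finset.equivalence_partition; apply: eq_imset => i.
apply/setP => j; rewrite !inE !ffunE /= (inj_eq ginj) -(inj_eq val_inj) /=.
by rewrite finset.eq_pblock // cov inE.
Qed.

Lemma sum_kernel (C : comNzRingType) (G : {ffun S -> T} -> C) (c : {set {set S}} -> C) :
  (forall k, G k = c (kernel k)) ->
  \sum_k G k = \sum_(P | finset.partition P [set: S]) (#|T| ^_ #|P|)%:R * c P.
Proof.
move=> h; rewrite (partition_big kernel (fun P => finset.partition P [set: S])) /=; last first.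
  by move=> k _; exact: kernel_partition.
apply: eq_bigr => P partP; rewrite -card_kernel // mulr_natl -sumr_const.
by apply: eq_big => [k|k /eqP]; rewrite ?inE // h => ->.
Qed.
End Kernel.

Lemma big_enum_ordered (R : Type) (idx : R) (op : R -> R -> R) (T : finType) (F : T -> R) :
  \big[op/idx]_(s <- enum T) F s = \big[op/idx]_s F s.
Proof. by rewrite enumT [index_enum T]unlock. Qed.

(** * Moments of the sums as sums over partitions *)

Section SumMoments.
Variables (C : fieldType) (I J : Type) (A : two_state_ncps C) (N : nat).
Variable a : nat -> I + J -> A.
Hypothesis free_a : c_bi_free_families (fun n : 'I_N => a n).
Hypothesis same_a : forall n m, (n < N)%N -> (m < N)%N -> identically_distributed (a n) (a m).
Variables (d : nat) (alpha : 'I_d -> I + J).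
Hypothesis d_gt0 : (0 < d)%N.

Lemma same_moments n m v : (n < N)%N -> (m < N)%N ->
  psi_moment a n v = psi_moment a m v /\ phi_moment a n v = phi_moment a m v.
Proof.
move=> hn hm; rewrite /psi_moment /phi_moment; case: v => [|x v].
  by rewrite !big_nil !ncps_psi1 !ncps_phi1.
rewrite !(big_tnth _ _ (x :: v)).
by have [-> ->] := same_a hn hm (tnth (in_tuple (x :: v))) isT.
Qed.

(** The common value of the mixed moments over all colourings with kernel [P], with family 0 as
    representative. *)
Definition psi_term (P : {set {set 'I_d}}) : C :=
  val_rec (finset.pblock P) (fun i => face_of (alpha i))
    (fun V => psi_moment a 0 (map alpha V)) (fun w => (nilp w)%:R)
    (rev (enum 'I_d)) [::].

Definition phi_term (P : {set {set 'I_d}}) : C :=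
  val_rec (finset.pblock P) (fun i => face_of (alpha i))
    (fun V => psi_moment a 0 (map alpha V))
    (fun w => \prod_(x <- w)
       (phi_moment a 0 (map alpha x.2) - psi_moment a 0 (map alpha x.2)))
    (rev (enum 'I_d)) [::].

Lemma colored_moments (P : {set {set 'I_d}}) (pick_col : {set 'I_d} -> 'I_N) (k : 'I_d -> 'I_N) :
  (forall i, pick_col (finset.pblock P i) = k i) ->
  (forall i j, k i = k j -> finset.pblock P i = finset.pblock P j) ->
  ncps_psi A (\prod_s a (k s) (alpha s)) = psi_term P /\
  ncps_phi A (\prod_s a (k s) (alpha s)) = phi_term P.
Proof.
move=> h1 h2; have N0 : (0 < N)%N by apply: leq_ltn_trans (ltn_ord (k (Ordinal d_gt0))).
have := @mixed_moments C I J A 'I_N _ free_a _ _ _ alpha k pick_col (Ordinal N0) h1 h2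
  (fun i j v => (same_moments v (ltn_ord i) (ltn_ord j)).1)
  (fun i j v => (same_moments v (ltn_ord i) (ltn_ord j)).2) (enum 'I_d).
by rewrite !big_enum_ordered.
Qed.

Lemma sum_moments :
  ncps_psi A (\prod_s \sum_(n < N) a n (alpha s))
    = \sum_(P | finset.partition P [set: 'I_d]) (N ^_ #|P|)%:R * psi_term P /\
  ncps_phi A (\prod_s \sum_(n < N) a n (alpha s))
    = \sum_(P | finset.partition P [set: 'I_d]) (N ^_ #|P|)%:R * phi_term P.
Proof.
rewrite bigA_distr_bigA !linear_sum /=.
have h (k : {ffun 'I_d -> 'I_N}) :
    ncps_psi A (\prod_s a (k s) (alpha s)) = psi_term (kernel k) /\
    ncps_phi A (\prod_s a (k s) (alpha s)) = phi_term (kernel k).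
  pose i0 (V : {set 'I_d}) := odflt (Ordinal d_gt0) [pick i in V].
  have /and3P[/eqP cov triv _] := kernel_partition k.
  apply: (@colored_moments _ (fun V => k (i0 V))) => [i|i j e]; last first.
    by apply/eqP; rewrite pblock_kernel e.
  rewrite /i0; case: pickP => [j ji|/(_ i)] /=; last by rewrite finset.mem_pblock cov inE.
  apply/eqP; rewrite -pblock_kernel; apply/eqP.
  by apply: finset.def_pblock; rewrite ?finset.pblock_mem // cov inE.
have := sum_kernel (fun k => (h k).1); have := sum_kernel (fun k => (h k).2).
by rewrite card_ord => -> ->.
Qed.

(** The constant colouring by family 0 has the one-block kernel, and its mixed moment is a moment of
    that family. *)
Lemma one_block_term : (0 < N)%N ->
  psi_term [set [set: 'I_d]] = psi_moment a 0 (map alpha (enum 'I_d)) /\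
  phi_term [set [set: 'I_d]] = phi_moment a 0 (map alpha (enum 'I_d)).
Proof.
move=> N0; have e i : finset.pblock [set [set: 'I_d]] i = [set: 'I_d].
  apply: finset.def_pblock; rewrite ?inE //.
  by apply/finset.trivIsetP => V W /finset.set1P -> /finset.set1P ->; rewrite eqxx.
have [] := @colored_moments [set [set: 'I_d]] (fun=> Ordinal N0) (fun=> Ordinal N0) (fun=> erefl).
  by move=> i j _; rewrite !e.
move=> <- <-; rewrite /psi_moment /phi_moment !big_map.
by split; congr (_ _); rewrite -big_enum_ordered.
Qed.
End SumMoments.

(** * The limit theorem *)

Section FreeAlgebra.
Import -(notations) monalg.
Variables (C : fieldType) (T : choiceType).

(** Noncommutative polynomials, as the monoid algebra of the free monoid. *)
Definition free_algebra : Type := malg (fmonom T) C.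
HB.instance Definition _ := GRing.Lalgebra.on free_algebra.

Lemma free_algebra_scalerAr (c : C) (x y : free_algebra) : c *: (x * y) = x * (c *: y).
Proof.
rewrite (malgMEw (finmap.fsubset_refl _) (finmap.fsubset_refl (msupp y))).
rewrite (malgMEw (finmap.fsubset_refl _) (msuppZ_le c y)) scaler_sumr.
apply: eq_bigr => u _; rewrite scaler_sumr; apply: eq_bigr => v _.
rewrite mcoeffZ mulrCA; apply/(@malgP (fmonom T) C) => w.
apply: etrans (mcoeffZ c _ w) _; apply: etrans _ (esym (mcoeffU _ _ w)).
by rewrite [mcoeff w (mkmalgU _ _)]mcoeffU mulrnAr.
Qed.

HB.instance Definition _ :=
  GRing.Lalgebra_isAlgebra.Build C free_algebra free_algebra_scalerAr.

Definition free_gen (t : T) : free_algebra := mkmalgU (FMonom [:: t]) 1.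

Lemma prod_free_gen (v : seq T) : \prod_(t <- v) free_gen t = mkmalgU (FMonom v) 1.
Proof.
elim: v => [|t v IH]; first by rewrite big_nil [LHS]/(malgC 1) /mone /= fmoneE.
by rewrite big_cons IH [LHS]fgmulUU mulr1 /mmul /= fmmulE.
Qed.

Variable m : seq T -> C.

Definition free_functional (x : free_algebra) : C := mmap idfun (fun w : fmonom T => m w) x.

Lemma free_functional_linear : linear_for *%R free_functional.
Proof.
move=> c x y; rewrite /free_functional mmapD; congr (_ + _).
rewrite (mmapEw (msuppZ_le c x)) mmapE mulr_sumr; apply: eq_bigr => w _.
by rewrite mcoeffZ mulrA.
Qed.

HB.instance Definition _ :=
  GRing.isLinear.Build C free_algebra C *%R free_functional free_functional_linear.

Lemma free_functional_prod (v : seq T) :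
  free_functional (\prod_(t <- v) free_gen t) = m v.
Proof. by rewrite prod_free_gen /free_functional mmapU mul1r. Qed.
End FreeAlgebra.

(** Words form a basis of the free algebra, so the prescribed values extend linearly, and the value
    1 on the empty word makes the functionals unital. *)
Lemma exists_ncps (C : fieldType) (T : Type) (phi psi : seq T -> C) :
  phi [::] = 1 -> psi [::] = 1 ->
  exists (B : two_state_ncps C) (s : T -> B), forall v,
    ncps_phi B (\prod_(t <- v) s t) = phi v /\ ncps_psi B (\prod_(t <- v) s t) = psi v.
Proof.
move=> phi1 psi1; pose A : algType C := free_algebra C {classic T}.
pose ev (m : seq T -> C) : {scalar A} := @free_functional C {classic T} m.
have ev1 m : ev m 1 = m [::] by rewrite -[RHS](@free_functional_prod C {classic T}) big_nil.
pose B := TwoStateNcps (etrans (ev1 phi) phi1) (etrans (ev1 psi) psi1).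
by exists B, (@free_gen C {classic T}) => v; split; exact: free_functional_prod.
Qed.

(** * Limits of the partition terms *)

Section BlockLimit.
Variables (C : numFieldType) (I J : Type).
Hypothesis tends_inv : @tends C (fun N => N%:R^-1) 0.
Variables (A : nat -> two_state_ncps C) (a : forall N, nat -> I + J -> A N).
Variables (lpsi lphi : seq (I + J) -> C) (m : nat).
Hypothesis psi_cvg : forall v, (0 < size v < m)%N ->
  tends (fun N => N%:R * psi_moment (a N) 0 v) (lpsi v).
Hypothesis phi_cvg : forall v, (0 < size v < m)%N ->
  tends (fun N => N%:R * phi_moment (a N) 0 v) (lphi v).
Opaque tends.

Variables (d : nat) (alpha : 'I_d -> I + J) (P : {set {set 'I_d}}).
Hypothesis d_gt0 : (0 < d)%N.
Hypothesis partP : finset.partition P [set: 'I_d].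
Hypothesis small_blocks : forall V, V \in P -> (#|V| < m)%N.
Local Notation chi := (fun i => face_of (alpha i)).
Local Notation lim l V := (l (map alpha (enum V))).

Let psi1_cvg (V : seq 'I_d) : (0 < size V < m)%N ->
  tends (scaled 1 (fun N => psi_moment (a N) 0 (map alpha V))) (lpsi (map alpha V)).
Proof. by rewrite -(size_map alpha) => /psi_cvg. Qed.

Let phi1_cvg (V : seq 'I_d) : (0 < size V < m)%N ->
  tends (scaled 1 (fun N => phi_moment (a N) 0 (map alpha V))) (lphi (map alpha V)).
Proof. by rewrite -(size_map alpha) => /phi_cvg. Qed.

Let count_block V : (count (fun j => finset.pblock P j == V) (rev (enum 'I_d)) < m)%N.
Proof.
have [i _] : exists i : 'I_d, true by exists (Ordinal d_gt0).
have iP : finset.pblock P i \in P.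
  by rewrite finset.pblock_mem //; case/and3P: partP => /eqP ->; rewrite inE.
rewrite count_rev; case: (boolP (V \in P)) => VP.
  apply: leq_ltn_trans (small_blocks VP); rewrite cardE /(enum V) enumT size_filter.
  by apply: eq_leq; apply: eq_count => j; rewrite /= pblock_eqE.
rewrite (@eq_count _ _ pred0) ?count_pred0; first by case: m (small_blocks iP).
move=> j /=; apply/negbTE; apply: contra VP => /eqP <-.
by rewrite finset.pblock_mem //; case/and3P: partP => /eqP ->; rewrite inE.
Qed.

Let weight_start : weight (finset.pblock P) (rev (enum 'I_d)) [::] = #|P|.
Proof.
by rewrite /weight add0n; apply: eq_card => V; rewrite !inE recurs_enum // andbT.
Qed.

(** The recursion starts with weight [#|P|], which matches the number of colourings, so the limit is
    the leading term. *)
Lemma psi_term_cvg :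
  tends (fun N => (N ^_ #|P|)%:R * psi_term (a N) alpha P)
    (if noncrossing chi P then \prod_(V in P) lim lpsi V else 0).
Proof.
apply: scaled_ffact => //; rewrite -(lead_rec_psi chi partP (fun V => lpsi (map alpha V)) d_gt0).
rewrite -weight_start; apply: (val_rec_cvg tends_inv (m := m)) => // w _.
case: w => [|x w].
  by rewrite /scaled; under eq_fun do rewrite expr0 mul1r; exact: tends_cst.
by rewrite /scaled /=; under eq_fun do rewrite mulr0; exact: tends_cst.
Qed.

Lemma phi_term_cvg :
  tends (fun N => (N ^_ #|P|)%:R * phi_term (a N) alpha P)
    (if noncrossing chi P then
       (\prod_(V in P | interior_block chi P V) lim lpsi V) *
       (\prod_(V in P | ~~ interior_block chi P V) lim lphi V)
     else 0).
Proof.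
apply: scaled_ffact => //.
rewrite -(lead_rec_phi chi partP (fun V => lpsi (map alpha V)) (fun V => lphi (map alpha V)) d_gt0).
rewrite -weight_start; apply: (val_rec_cvg tends_inv (m := m)) => // w.
elim: w => [|x w IH] hw.
  rewrite big_nil /scaled; under eq_fun do rewrite expr0 big_nil mulr1.
  exact: tends_cst.
rewrite big_cons; under eq_fun do rewrite big_cons.
(* Each letter left in the word is one difference of moments, which converges after scaling by
   [N]. *)
move: hw => /= /andP[hx /IH]; rewrite -[(size w).+1]add1n; apply: scaledM.
exact: (scaledB (phi1_cvg hx) (psi1_cvg hx)).
Qed.
End BlockLimit.

(** Cumulants take functions on ordinals while limits are indexed by words; this transports along an
    equality of lengths for any dependent [G]. *)
Lemma word_family (T Z : Type) (G : forall m, ('I_m -> T) -> Z) n (b : 'I_n -> T) v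
    (e : size v = n) :
  (forall i, tnth (in_tuple v) i = b (cast_ord e i)) ->
  G (size v) (tnth (in_tuple v)) = G n b.
Proof.
case: n / e b => b h; congr (G _ _).
by apply: funext => i; rewrite h; congr b; exact: val_inj.
Qed.

Lemma word_restr (T Z : Type) (G : forall m, ('I_m -> T) -> Z) d (alpha : 'I_d -> T)
    (V : {set 'I_d}) :
  let v := map alpha (enum V) in
  G (size v) (tnth (in_tuple v)) = G #|V| (restr V alpha).
Proof.
have e : size (map alpha (enum V)) = #|V| by rewrite size_map -cardE.
apply: (@word_family _ _ G _ _ _ e) => i; pose x0 := enum_val (cast_ord e i).
rewrite (tnth_nth (alpha x0)) (nth_map x0); last by rewrite -cardE -[X in (_ < X)%N]e.
by rewrite /restr (enum_val_nth x0).
Qed.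

Lemma joint_monomial_word (C : fieldType) (I J : Type) (B : algType C) (b : I + J -> B)
    d (alpha : 'I_d -> I + J) :
  joint_monomial b alpha = \prod_(x <- map alpha (enum 'I_d)) b x.
Proof. by rewrite big_map big_enum_ordered. Qed.

Lemma size_word (T : Type) d (alpha : 'I_d -> T) : size (map alpha (enum 'I_d)) = d.
Proof. by rewrite size_map size_enum_ord. Qed.

(** * Comparison with the moment-cumulant formulas *)

Section LimitTheorem.
Variables (C : numFieldType) (I J : Type).
Hypothesis tends_inv : @tends C (fun N => N%:R^-1) 0.
Variables (A : nat -> two_state_ncps C) (a : forall N, nat -> I + J -> A N).
Hypothesis free_a : forall N, c_bi_free_families (fun n : 'I_N => a N n).
Hypothesis same_a : forall N n m, (n < N)%N -> (m < N)%N ->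
  identically_distributed (a N n) (a N m).
Opaque tends.

Let S N k := \sum_(n < N) a N n k.

Definition word_kappa (B : two_state_ncps C) (s : I + J -> B) v : C :=
  kappa (fun i => face_of (tnth (in_tuple v) i)) (fun i => s (tnth (in_tuple v) i)).
Definition word_ckappa (B : two_state_ncps C) (s : I + J -> B) v : C :=
  ckappa (fun i => face_of (tnth (in_tuple v) i)) (fun i => s (tnth (in_tuple v) i)).

Definition converges (B : two_state_ncps C) (s : I + J -> B) : Prop :=
  forall d (alpha : 'I_d -> I + J), (0 < d)%N ->
    tends (fun N => ncps_phi (A N) (joint_monomial (S N) alpha))
          (ncps_phi B (joint_monomial s alpha)) /\
    tends (fun N => ncps_psi (A N) (joint_monomial (S N) alpha))
          (ncps_psi B (joint_monomial s alpha)).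

(** The one-block partition contributes [N ^_ 1], that is [N], times a moment of one family; the sum
    over partitions is solved for it. *)
Let sum_split (d : nat) (alpha : 'I_d -> I + J) (v : seq (I + J)) N :
  (0 < d)%N -> (0 < N)%N -> map alpha (enum 'I_d) = v ->
  N%:R * psi_moment (a N) 0 v = ncps_psi (A N) (joint_monomial (S N) alpha)
    - \sum_(P | finset.partition P [set: 'I_d] && (P != [set [set: 'I_d]]))
        (N ^_ #|P|)%:R * psi_term (a N) alpha P /\
  N%:R * phi_moment (a N) 0 v = ncps_phi (A N) (joint_monomial (S N) alpha)
    - \sum_(P | finset.partition P [set: 'I_d] && (P != [set [set: 'I_d]]))
        (N ^_ #|P|)%:R * phi_term (a N) alpha P.
Proof.
move=> d0 N0 <-; rewrite /joint_monomial.
have [-> ->] := sum_moments (free_a N) (@same_a N) alpha d0.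
have [<- <-] := one_block_term (free_a N) (@same_a N) alpha d0 N0.
have part1 : finset.partition [set [set: 'I_d]] [set: 'I_d].
  by have := one_block_BNC (fun i => face_of (alpha i)) d0; rewrite inE => /andP[].
by split; rewrite (bigD1 [set [set: 'I_d]] part1) /= cards1 ffactn1 addrK.
Qed.

(** Strong induction on the length. All other partitions have shorter blocks, whose limits are
    already cumulants; subtracting their terms from the moment leaves the cumulant of the whole
    word. *)
Lemma cumulant_limits (B : two_state_ncps C) (s : I + J -> B) : converges s ->
  forall v, (0 < size v)%N ->
    tends (fun N => N%:R * psi_moment (a N) 0 v) (word_kappa s v) /\
    tends (fun N => N%:R * phi_moment (a N) 0 v) (word_ckappa s v).
Proof.
move=> hs v; have [n le_n] := ubnP (size v); elim: n v le_n => // n IH v le_n v0.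
set d := size v in v0 *; pose alpha := tnth (in_tuple v).
have ev : map alpha (enum 'I_d) = v by exact: map_tnth_enum.
have hpsi u : (0 < size u < d)%N ->
    tends (fun N => N%:R * psi_moment (a N) 0 u) (word_kappa s u).
  move=> /andP[u0 ud]; apply: (IH u _ u0).1.
  exact: leq_trans ud le_n.
have hphi u : (0 < size u < d)%N ->
    tends (fun N => N%:R * phi_moment (a N) 0 u) (word_ckappa s u).
  move=> /andP[u0 ud]; apply: (IH u _ u0).2.
  exact: leq_trans ud le_n.
have [cphi cpsi] := hs d alpha v0.
have small (P : {set {set 'I_d}}) : finset.partition P [set: 'I_d] -> P != [set [set: 'I_d]] ->
    forall V, V \in P -> (#|V| < d)%N.
  by move=> h1 h2 V; exact: card_block.
pose chi i := face_of (alpha i).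
have kV (V : {set 'I_d}) : word_kappa s (map alpha (enum V))
    = kappa (restr V chi) (restr V (fun i => s (alpha i))).
  exact: (word_restr (fun m b => kappa (fun i => face_of (b i)) (fun i => s (b i)))).
have cV (V : {set 'I_d}) : word_ckappa s (map alpha (enum V))
    = ckappa (restr V chi) (restr V (fun i => s (alpha i))).
  exact: (word_restr (fun m b => ckappa (fun i => face_of (b i)) (fun i => s (b i)))).
have BNC_split P : (P \in BNC chi) && (P != [set [set: 'I_d]])
    = finset.partition P [set: 'I_d] && (P != [set [set: 'I_d]]) && noncrossing chi P.
  by rewrite inE andbAC.
split.
  apply: (@tends_eventually _ 1); first by move=> N N0; exact: (sum_split v0 N0 ev).1.
  have -> : word_kappa s v = ncps_psi B (joint_monomial s alpha)
    - \sum_(P | finset.partition P [set: 'I_d] && (P != [set [set: 'I_d]]))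
        (if noncrossing chi P then \prod_(V in P) word_kappa s (map alpha (enum V)) else 0).
    rewrite /joint_monomial (moment_kappa chi) // (bigD1 _ (one_block_BNC chi v0)).
    rewrite finset.big_set1 (restr_setT chi _ (fun m f b => kappa f b)).
    rewrite [X in _ + X - _](_ : _ =
      \sum_(P | finset.partition P [set: 'I_d] && (P != [set [set: 'I_d]]))
        (if noncrossing chi P then \prod_(V in P) word_kappa s (map alpha (enum V)) else 0)).
      by rewrite addrK.
    rewrite -big_mkcondr; apply: eq_big => [P|P _]; first exact: BNC_split.
    by apply: eq_bigr => V _; rewrite kV.
  apply: (tendsD cpsi); apply: tendsN; apply: tends_sum => P /andP[h1 h2].
  exact: (psi_term_cvg tends_inv hpsi v0 h1 (small P h1 h2)).
apply: (@tends_eventually _ 1); first by move=> N N0; exact: (sum_split v0 N0 ev).2.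
have -> : word_ckappa s v = ncps_phi B (joint_monomial s alpha)
  - \sum_(P | finset.partition P [set: 'I_d] && (P != [set [set: 'I_d]]))
      (if noncrossing chi P then
        (\prod_(V in P | interior_block chi P V) word_kappa s (map alpha (enum V))) *
        (\prod_(V in P | ~~ interior_block chi P V) word_ckappa s (map alpha (enum V)))
       else 0).
  rewrite /joint_monomial (moment_ckappa chi) // (bigD1 _ (one_block_BNC chi v0)).
  rewrite ![in X in X + _ - _]big_mkcondr !finset.big_set1 one_block_exterior mul1r.
  rewrite (restr_setT chi _ (fun m f b => ckappa f b)).
  rewrite [X in _ + X - _](_ : _ =
      \sum_(P | finset.partition P [set: 'I_d] && (P != [set [set: 'I_d]]))
      (if noncrossing chi P then
        (\prod_(V in P | interior_block chi P V) word_kappa s (map alpha (enum V))) *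
        (\prod_(V in P | ~~ interior_block chi P V) word_ckappa s (map alpha (enum V)))
       else 0)).
    by rewrite addrK.
  rewrite -big_mkcondr; apply: eq_big => [P|P _]; first exact: BNC_split.
  by congr (_ * _); apply: eq_bigr => V _; rewrite ?kV ?cV.
apply: (tendsD cphi); apply: tendsN; apply: tends_sum => P /andP[h1 h2].
exact: (phi_term_cvg tends_inv hpsi hphi v0 h1 (small P h1 h2)).
Qed.

(** Family [n] has the moments of family 0 as soon as N exceeds n, so both have the same limits. *)
Let scaled_moment n d (alpha : 'I_d -> I + J) l l' :
  tends (fun N => N%:R * psi_moment (a N) 0 (map alpha (enum 'I_d))) l ->
  tends (fun N => N%:R * phi_moment (a N) 0 (map alpha (enum 'I_d))) l' ->
  tends (fun N => N%:R * ncps_psi (A N) (joint_monomial (a N n) alpha)) l /\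
  tends (fun N => N%:R * ncps_phi (A N) (joint_monomial (a N n) alpha)) l'.
Proof.
have h N : (n < N)%N -> _ :=
  fun hn => same_moments (@same_a N) (map alpha (enum 'I_d)) hn (leq_ltn_trans (leq0n n) hn).
move=> h1 h2; split.
  apply: (tends_eventually (M := n.+1) _ h1) => N hN.
  by rewrite joint_monomial_word -(h N hN).1.
apply: (tends_eventually (M := n.+1) _ h2) => N hN.
by rewrite joint_monomial_word -(h N hN).2.
Qed.

Lemma cumulants_of_limit (B : two_state_ncps C) (s : I + J -> B) : converges s ->
  forall d (alpha : 'I_d -> I + J), (0 < d)%N -> forall n,
  tends (fun N => N%:R * ncps_psi (A N) (joint_monomial (a N n) alpha))
    (kappa (fun i => face_of (alpha i)) (fun i => s (alpha i))) /\
  tends (fun N => N%:R * ncps_phi (A N) (joint_monomial (a N n) alpha))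
    (ckappa (fun i => face_of (alpha i)) (fun i => s (alpha i))).
Proof.
move=> hs d alpha d0 n; set v := map alpha (enum 'I_d).
have v0 : (0 < size v)%N by rewrite size_word.
have [h1 h2] := cumulant_limits hs v0.
have e i : tnth (in_tuple v) i = alpha (cast_ord (size_word alpha) i).
  pose x0 := cast_ord (size_word alpha) i.
  rewrite (tnth_nth (alpha x0)) (nth_map x0) ?size_enum_ord //; last exact: (ltn_ord x0).
  by congr alpha; apply: val_inj; rewrite /= nth_enum_ord //; exact: (ltn_ord x0).
have e1 := word_family (fun m b => kappa (fun i => face_of (b i)) (fun i => s (b i))) e.
have e2 := word_family (fun m b => ckappa (fun i => face_of (b i)) (fun i => s (b i))) e.
rewrite -e1 -e2; exact: scaled_moment.
Qed.

Lemma limit_of_moments :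
  (forall d (alpha : 'I_d -> I + J), (0 < d)%N ->
    (exists l, forall n,
       tends (fun N => N%:R * ncps_psi (A N) (joint_monomial (a N n) alpha)) l) /\
    (exists l, forall n,
       tends (fun N => N%:R * ncps_phi (A N) (joint_monomial (a N n) alpha)) l)) ->
  exists (B : two_state_ncps C) (s : I + J -> B), converges s.
Proof.
move=> h.
have word_ex v : exists l : C * C, (0 < size v)%N ->
    tends (fun N => N%:R * psi_moment (a N) 0 v) l.1 /\
    tends (fun N => N%:R * phi_moment (a N) 0 v) l.2.
  case: (posnP (size v)) => [_|v0]; first by exists (0, 0).
  have [[l1 /(_ 0%N) h1] [l2 /(_ 0%N) h2]] := h _ (tnth (in_tuple v)) v0.
  exists (l1, l2) => _ /=; split.
    apply: (tends_eventually (M := 0) _ h1) => N _.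
    by rewrite joint_monomial_word map_tnth_enum.
  apply: (tends_eventually (M := 0) _ h2) => N _.
  by rewrite joint_monomial_word map_tnth_enum.
have [l hl] := choice word_ex.
(* The empty word gets the value 1 for unitality. The [phi] value comes first here, whereas [l]
   holds the [psi] limit first. *)
have moment_ex v : exists M : C * C, if nilp v then M = (1, 1) else
    tends (fun N => ncps_phi (A N) (\prod_(x <- v) S N x)) M.1 /\
    tends (fun N => ncps_psi (A N) (\prod_(x <- v) S N x)) M.2.
  case: (posnP (size v)) => [/size0nil ->|v0]; first by exists (1, 1).
  pose alpha := tnth (in_tuple v); pose chi i := face_of (alpha i).
  (* The limits are now given for all lengths, so the bound admits the whole word as a block and
     every partition term converges. *)
  have small (P : {set {set 'I_(size v)}}) V : V \in P -> (#|V| < (size v).+1)%N.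
    by move=> _; rewrite ltnS -[X in (_ <= X)%N]card_ord max_card.
  have hpsi u : (0 < size u < (size v).+1)%N ->
      tends (fun N => N%:R * psi_moment (a N) 0 u) (l u).1.
    by move=> /andP[u0 _]; exact: (hl u u0).1.
  have hphi u : (0 < size u < (size v).+1)%N ->
      tends (fun N => N%:R * phi_moment (a N) 0 u) (l u).2.
    by move=> /andP[u0 _]; exact: (hl u u0).2.
  eexists (_, _); rewrite /nilp gtn_eqF //=; split.
    apply: (@tends_eventually _ 0) => [N _|].
      rewrite big_tnth; exact: (sum_moments (free_a N) (@same_a N) alpha v0).2.
    apply: tends_sum => P partP.
    exact: (phi_term_cvg tends_inv hpsi hphi v0 partP (@small P)).
  apply: (@tends_eventually _ 0) => [N _|].
    rewrite big_tnth; exact: (sum_moments (free_a N) (@same_a N) alpha v0).1.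
  apply: tends_sum => P partP.
  exact: (psi_term_cvg tends_inv hpsi v0 partP (@small P)).
have [M hM] := choice moment_ex.
have /= M1 := hM [::].
have [B [s hB]] := @exists_ncps C (I + J) (fun v => (M v).1) (fun v => (M v).2)
  (congr1 fst M1) (congr1 snd M1).
exists B, s => d alpha d0; have := hM (map alpha (enum 'I_d)).
rewrite /nilp size_word gtn_eqF // => -[h1 h2].
rewrite joint_monomial_word !(hB _).1 !(hB _).2; split.
  by apply: (@tends_eventually _ 0) h1 => N _; rewrite joint_monomial_word.
by apply: (@tends_eventually _ 0) h2 => N _; rewrite joint_monomial_word.
Qed.
End LimitTheorem.

(* The families of row N are a N 0, ..., a N (N - 1); the values a N n with
   N <= n are unconstrained and affect no limit, since n is fixed as N grows. *)
Theorem theorem6p5 (R : realType) (I J : Type)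
    (A : nat -> two_state_ncps R[i])
    (a : forall N : nat, nat -> I + J -> A N)
    (hfree : forall N : nat,
       c_bi_free_families (fun n : 'I_N => a N (nat_of_ord n)))
    (hid : forall N n m : nat, (n < N)%N -> (m < N)%N ->
       identically_distributed (a N n) (a N m)) :
  let S := fun (N : nat) (k : I + J) => \sum_(n < N) a N (nat_of_ord n) k in
  ((exists (B : two_state_ncps R[i]) (s : I + J -> B), cvg_in_distribution S s)
   <->
   (forall (d : nat) (alpha : 'I_d -> I + J), (0 < d)%N ->
      (exists l : R[i], forall n : nat, complex_cvg (scaled_psi_moment a n alpha) l) /\
      (exists l : R[i], forall n : nat, complex_cvg (scaled_phi_moment a n alpha) l)))
  /\
  (forall (B : two_state_ncps R[i]) (s : I + J -> B), cvg_in_distribution S s ->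
     forall (d : nat) (alpha : 'I_d -> I + J), (0 < d)%N ->
     forall n : nat,
       complex_cvg (scaled_psi_moment a n alpha)
         (kappa (fun i => face_of (alpha i)) (fun i => s (alpha i))) /\
       complex_cvg (scaled_phi_moment a n alpha)
         (ckappa (fun i => face_of (alpha i)) (fun i => s (alpha i)))).
Proof.
have inv := @tends_invn R.
have cumulants (B : two_state_ncps R[i]) (s : I + J -> B) :=
  @cumulants_of_limit R[i] I J inv A a hfree hid B s.
split; [split|].
(* The cumulants of the limit family serve as the limits, and they do not involve [n]. *)
- move=> [B [s /cumulants h]] d alpha d0; have {}h := h d alpha d0; split.
    by eexists => n; exact: (h n).1.
  by eexists => n; exact: (h n).2.
- exact: (@limit_of_moments R[i] I J inv A a hfree hid).
- exact: cumulants.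
Qed.
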